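(* Let $G$ be any locally finite, connected graph that is transient for simple random walk. For every cluster observable $F:\mathcal X\to\mathbb C$ of subexponential growth and every $X\in\mathcal X$, the function $\overline F^X(h)=\mathbb E\big[F(\mathcal C_X(h))\mathbf 1_{\{|\mathcal C_X(h)|<\infty\}}\big]$ is well-defined and analytic on $(-\infty,0)$.
   Context: For $G=(V,E)$, let $P_x$ be the law of simple random walk $(X_n)$ started at $x$, $d(y)$ the degree of $y$, and $g(x,y)=\frac{1}{d(y)}\sum_{n\ge0}P_x[X_n=y]$. The GFF $\varphi$ is the centered Gaussian field on $V$ with covariance $g$. Clusters are connected components of the induced subgraph $\{\varphi\ge h\}$. $\mathcal X$ is the family of finite subsets of $V$; for $X\in\mathcal X$, $\mathcal C_X(h)$ is the union of the clusters of $\{\varphi\ge h\}$ intersecting $X$. For $S\subset V$, $\partial^{out}S=\{x\in V\setminus S:\exists y\in S,x\sim y\}$, $\overline S=S\cup\partial^{out}S$. For finite $K$, $\mathrm{cap}(K)=\sum_{x\in K}d(x)P_x[\widetilde H_K=\infty]$, $\widetilde H_K=\min\{n\ge1:X_n\in K\}$. A cluster observable $F:\mathcal X\to\mathbb C$ has subexponential growth if for every $\eta>0$ there is $C_\eta<\infty$ with $|F(S)|\le C_\eta e^{\eta\,\mathrm{cap}(\overline S)}$ for all $S\in\mathcal X$. *)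

(* Defs.v *)
From HB Require Import structures.
From mathcomp Require Import all_boot all_order all_algebra.
From mathcomp Require Import finmap.
From mathcomp Require Import all_classical all_reals all_analysis.
From mathcomp Require Import complex.
Set Implicit Arguments. Unset Strict Implicit. Unset Printing Implicit Defensive.
Import Order.TTheory GRing.Theory Num.Theory.
Import numFieldNormedType.Exports.
Local Open Scope classical_set_scope.
Local Open Scope ring_scope.

Section Graph.
Variable V : choiceType.
Variable nbrs : V -> seq V.

Definition adj (x y : V) : bool := y \in nbrs x.

Definition simple_locally_finite_graph : Prop :=
  [/\ forall x y, adj x y = adj y x,
      forall x, ~~ adj x x &
      forall x, uniq (nbrs x)].

Definition deg (x : V) : nat := size (nbrs x).

Definition connected_graph : Prop :=
  forall x y : V, exists s : seq V, path adj x s /\ last x s = y.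

Variable R : realType.

Fixpoint srw_prob (n : nat) (x y : V) : R :=
  match n with
  | 0 => (x == y)%:R
  | n'.+1 => (deg x)%:R^-1 * \sum_(z <- nbrs x) srw_prob n' z y
  end.

Definition visits (x y : V) : \bar R := (\sum_(0 <= n <oo) (srw_prob n x y)%:E)%E.

Definition transient : Prop := forall x : V, (visits x x < +oo)%E.

Definition green (x y : V) : R := fine (visits x y) / (deg y)%:R.

(* avoid_prob K n x = P_x[X_1 \notin K, ..., X_n \notin K] *)
Fixpoint avoid_prob (K : {fset V}) (n : nat) (x : V) : R :=
  match n with
  | 0 => 1
  | n'.+1 => (deg x)%:R^-1 *
      \sum_(z <- nbrs x) (if z \in K then 0 else avoid_prob K n' z)
  end.

Definition escape_prob (K : {fset V}) (x : V) : R :=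
  limn (fun n => avoid_prob K n x).

Definition capacity (K : {fset V}) : R :=
  \sum_(x <- K) (deg x)%:R * escape_prob K x.

Definition fclosure (S : {fset V}) : {fset V} :=
  (S `|` [fset y | y in flatten [seq nbrs x | x <- S]])%fset.

Local Open Scope complex_scope.

Definition subexponential_growth (F : {fset V} -> R[i]) : Prop :=
  forall eta : R, 0 < eta -> exists C : R,
    forall S : {fset V}, `|F S| <= (C * expR (eta * capacity (fclosure S)))%:C.

Section GFF.
Variables (d : measure_display) (T : measurableType d) (P : probability T R).

(* phi is a centered Gaussian field on V with covariance green:
   all finite-dimensional characteristic functions are Gaussian. *)
Definition is_GFF (phi : V -> T -> R) : Prop :=
  (forall x, measurable_fun setT (phi x)) /\
  forall (K : {fset V}) (a : V -> R),
    let Y := fun w => \sum_(x <- K) a x * phi x w in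
    let q := \sum_(x <- K) \sum_(y <- K) a x * a y * green x y in
    (\int[P]_w (cos (Y w))%:E = (expR (- q / 2))%:E)%E /\
    (\int[P]_w (sin (Y w))%:E = 0%E)%E.

Definition cluster (phi : V -> T -> R) (h : R) (X : {fset V}) (w : T) : set V :=
  [set y | exists2 x, x \in X &
     exists s : seq V, [/\ path adj x s, last x s = y &
                           all (fun v => h <= phi v w) (x :: s)]].

Definition obs_fin (F : {fset V} -> R[i]) (C : set V) : R[i] :=
  if `[< finite_set C >] then F (fset_set C) else 0.

Definition obs_integrable (phi : V -> T -> R) (F : {fset V} -> R[i])
    (X : {fset V}) (h : R) : Prop :=
  P.-integrable setT (fun w => (@complex.Re R (obs_fin F (cluster phi h X w)))%:E) /\
  P.-integrable setT (fun w => (@complex.Im R (obs_fin F (cluster phi h X w)))%:E).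

Definition Fbar (phi : V -> T -> R) (F : {fset V} -> R[i]) (X : {fset V})
    (h : R) : R[i] :=
  (fine (\int[P]_w (@complex.Re R (obs_fin F (cluster phi h X w)))%:E))
  +i* (fine (\int[P]_w (@complex.Im R (obs_fin F (cluster phi h X w)))%:E)).

End GFF.
End Graph.

Local Open Scope complex_scope.
(* real-analytic on D: locally a convergent power series (complex coefficients);
   convergence is in the norm topology of R[i] (via the regular alias R[i]^o) *)
Definition analytic_on (R : realType) (D : set R) (f : R -> R[i]) : Prop :=
  forall h0, D h0 -> exists (c : nat -> R[i]) (r : R), 0 < r /\
    forall h, `|h - h0| < r ->
      (fun N : nat => (\sum_(n < N) c n * ((h - h0)%:C) ^+ n : (R[i])^o))
        @ \oo --> (f h : (R[i])^o).

(* Main.v *)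
(** Consider the event that the cluster is the finite set [S]; let [K] be the closure
of [S] together with [X].  Let [e] be the equilibrium measure of [K], [c] its
capacity and [M] the integral of the field against [e].  Raising the level by [t]
amounts to shifting the field on [K] by the constant [- t], so the Cameron-Martin
formula gives [P[C(h + t) = S] = E[exp(- t M - t^2 c / 2); C(h) = S]].  Since [e]
charges no vertex of [S] and the field is below [h] on [K \ S], one has
[M <= h c] on this event; comparing the levels [h < 0] and [0] this yields
[E[exp(h^2 c / 2); C(h) finite] <= 1].  This exponential moment dominates any
subexponential observable, and it allows the expansion of
[exp(- t M - t^2 c / 2)] in powers of [t] under the expectation.

The Cameron-Martin formula itself only needs the field on [K].  The characteristic
functions show that this field has the law of [psi + u], where
[psi = phi - M / c] and [u] is an independent normal variable of variance [1 / c];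
the shift then acts on [u] alone. *)
Require Import Defs.
From HB Require Import structures.
From mathcomp Require Import all_boot all_order all_algebra.
From mathcomp Require Import finmap.
From mathcomp Require Import all_classical all_reals all_analysis.
From mathcomp Require Import complex.
From mathcomp Require Import measurable_realfun lebesgue_integral_under.
From mathcomp Require Import normal_distribution.
From mathcomp Require Import ring lra.
Import Order.TTheory GRing.Theory Num.Theory.
Import numFieldNormedType.Exports.
Local Open Scope classical_set_scope.
Local Open Scope ring_scope.
Set Implicit Arguments. Unset Strict Implicit. Unset Printing Implicit Defensive.

(** * Functions determined by characteristic functions *)

Section sign_iteration.
Context {R : realType}.
Implicit Types x : R.

(** Laws are compared through a class of functions instead of a uniqueness theorem in several
    variables: [trig_closure] is closed under the operations that preserve equality of integrals,
    and still reaches level events. The exponential weight is unbounded, hence outside the class; an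
    event times a linear form is therefore treated as one real variable, whose law is determined by
    half-lines.

    The sign of the level matters in the comparison with level 0: there [M <= 0], so [- h M <= 0]
    because [h <= 0], and the density is at most [exp (- h^2 c / 2)].

    The radius [- h / 4] comes from the price of a termwise bound. Absolute values turn
    [- t^2 c / 2] into [+ t^2 c / 2], which costs a factor [exp (t^2 c)] over a density. The shift
    to level [h + |t|] then asks for [t^2 < (h + |t|)^2 / 2], true for [|t| <= - h / 4]. *)

Definition sgstep x : R := (3 * x - x ^+ 3) / 2.

Lemma sgstep_ge x : 0 <= x <= 1 -> x <= sgstep x <= 1.
Proof.
move=> /andP[x0 x1]; rewrite -subr_ge0 -[_ <= 1]subr_ge0 /sgstep.
have -> : (3 * x - x ^+ 3) / 2 - x = x * (1 - x) * (1 + x) / 2 by field.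
have -> : 1 - (3 * x - x ^+ 3) / 2 = (1 - x) ^+ 2 * (2 + x) / 2 by field.
by rewrite !divr_ge0 ?mulr_ge0 ?sqr_ge0//; lra.
Qed.

Lemma iter_sgstep_ge n x : 0 <= x <= 1 -> x <= iter n sgstep x <= 1.
Proof.
move=> x01; elim: n => [|n IH] /=; first by rewrite lexx; case/andP: x01.
have /andP[x0 x1] := x01; have /andP[h1 h2] := IH.
have /sgstep_ge/andP[h3 ->] : 0 <= iter n sgstep x <= 1.
  by rewrite h2 (le_trans x0).
by rewrite (le_trans h1).
Qed.

Lemma iter_sgstepN n x : iter n sgstep (- x) = - iter n sgstep x.
Proof. by elim: n => //= n ->; rewrite /sgstep; field. Qed.

Lemma iter_sgstep_le1 n x : `|x| <= 1 -> `|iter n sgstep x| <= 1.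
Proof.
wlog x0 : x / 0 <= x.
  move=> H; case: (leP 0 x) => [/H//|x0 x1].
  by rewrite -normrN -iter_sgstepN H ?normrN// oppr_ge0 ltW.
rewrite ger0_norm// => x1; have /(iter_sgstep_ge n)/andP[h1 h2] : 0 <= x <= 1 by rewrite x0.
by rewrite ger0_norm// (le_trans x0).
Qed.

(** [sgstep] is the Newton-Schulz iteration for the sign, with fixed points -1, 0 and 1. Since
    [1 - sgstep z = (1 - z)^2 (2 + z) / 2] and the iterates stay above [x], each step multiplies the
    distance to 1 by at most [1 - x / 2]. *)
Lemma iter_sgstep_rate n x : 0 <= x <= 1 ->
  1 - iter n sgstep x <= (1 - x / 2) ^+ n.
Proof.
move=> x01; have /andP[x0 x1] := x01.
elim: n => [|n IH] /=; first by rewrite expr0; lra.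
have /andP[h1 h2] := iter_sgstep_ge n x01; rewrite exprS /sgstep.
set z := iter n _ x in IH h1 h2 *.
apply: (@le_trans _ _ ((1 - x / 2) * (1 - z))); last by rewrite ler_wpM2l//; lra.
have -> : 1 - (3 * z - z ^+ 3) / 2 = (1 - z) * (1 - z) * (2 + z) / 2 by field.
nra.
Qed.

Lemma cvg_iter_sgstep x : `|x| <= 1 -> iter n sgstep x @[n --> \oo] --> Num.sg x.
Proof.
wlog x0 : x / 0 <= x.
  move=> H; case: (leP 0 x) => [/H//|x0 x1].
  have /H : 0 <= - x by rewrite oppr_ge0 ltW.
  rewrite normrN => /(_ x1) /cvgN; rewrite sgrN opprK; apply: cvg_trans.
  by apply: near_eq_cvg; apply: nearW => n; rewrite fctE iter_sgstepN opprK.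
rewrite ger0_norm// => x1; move: x0; rewrite le_eqVlt => /predU1P[<-|x0].
  have it0 n : iter n sgstep 0 = 0 :> R.
    by elim: n => //= n ->; rewrite /sgstep expr0n /=; field.
  by rewrite sgr0; under eq_fun do rewrite it0; exact: cvg_cst.
rewrite gtr0_sg//; have x01 : 0 <= x <= 1 by rewrite ltW.
apply: (@squeeze_cvgr _ _ _ _ (fun n => 1 - (1 - x / 2) ^+ n) (cst 1)).
- apply: nearW => n; have /andP[_ ->] := iter_sgstep_ge n x01; rewrite andbT.
  by have := iter_sgstep_rate n x01; lra.
- rewrite -[X in _ --> X]subr0; apply: cvgB; first exact: cvg_cst.
  by apply: cvg_expr; rewrite ger0_norm; lra.
- exact: cvg_cst.
Qed.

(** For large [n] the argument lies in []-pi, pi[], where the sine has the sign of its argument. *)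
Lemma cvg_sg_sin x : Num.sg (sin (x / n.+1%:R)) @[n --> \oo] --> Num.sg x.
Proof.
apply: cvg_near_cst; near=> n.
have xn : `|x| / n.+1%:R < pi.
  rewrite ltr_pdivrMr// -ltr_pdivrMl ?pi_gt0//.
  apply: (@lt_trans _ _ n%:R); last by rewrite ltr_nat.
  by near: n; exact: nbhs_infty_gtr.
have [x0|x0|->] := ltgtP x 0; last by rewrite mul0r sin0.
- rewrite (ltr0_sg x0) -[x]opprK mulNr sinN sgrN gtr0_sg// sin_gt0_pi//.
  by rewrite divr_gt0 ?oppr_gt0//= -(ltr0_norm x0).
- by rewrite (gtr0_sg x0) gtr0_sg// sin_gt0_pi// divr_gt0//= -(gtr0_norm x0).
Unshelve. all: by end_near. Qed.

End sign_iteration.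

(** * Bounded limits of trigonometric functions of linear forms *)

Section trig_closure.
Context {R : realType} {I : Type}.
Variable s : seq I.
Implicit Types (a y : I -> R) (f g : (I -> R) -> R).

Definition lin_form a y : R := \sum_(i <- s) a i * y i.

Lemma lin_formD a b y : lin_form (fun i => a i + b i) y = lin_form a y + lin_form b y.
Proof. by rewrite /lin_form -big_split; apply: eq_bigr => i _; rewrite mulrDl. Qed.

Lemma lin_formZ k a y : lin_form (fun i => k * a i) y = k * lin_form a y.
Proof. by rewrite /lin_form big_distrr; apply: eq_bigr => i _ /=; rewrite mulrA. Qed.

Lemma lin_formB a b y : lin_form (fun i => a i - b i) y = lin_form a y - lin_form b y.
Proof.
rewrite -[X in _ = _ + X]mulN1r -lin_formZ -lin_formD; congr lin_form.
by apply/funext => i; rewrite mulN1r.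
Qed.

(* This class is an algebra and contains the indicators of half-spaces, and two
   laws with the same characteristic function agree on it. *)
Inductive trig_closure : ((I -> R) -> R) -> Prop :=
| tc_cos a : trig_closure (fun y => cos (lin_form a y))
| tc_sin a : trig_closure (fun y => sin (lin_form a y))
| tc_add f g : trig_closure f -> trig_closure g -> trig_closure (fun y => f y + g y)
| tc_scale k f : trig_closure f -> trig_closure (fun y => k * f y)
| tc_lim (u : nat -> (I -> R) -> R) g M : (forall n, trig_closure (u n)) ->
    (forall n y, `|u n y| <= M) ->
    (forall y, u n y @[n --> \oo] --> g y) -> trig_closure g.

Lemma trig_closure_bounded f : trig_closure f -> exists M, forall y, `|f y| <= M.
Proof.
elim=> {f}.
- by move=> a; exists 1 => y; rewrite ler_norml cos_geN1 cos_le1.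
- by move=> a; exists 1 => y; rewrite ler_norml sin_geN1 sin_le1.
- move=> f g _ [M fM] _ [N gN]; exists (M + N) => y.
  by rewrite (le_trans (ler_normD _ _))// lerD.
- by move=> k f _ [M fM]; exists (`|k| * M) => y; rewrite normrM ler_wpM2l.
- move=> u g M _ _ uM ug; exists M => y.
  have /cvg_norm := ug y => h; rewrite -(cvg_lim _ h)//.
  apply: limr_le; first by apply/cvg_ex; exists (`|g y|).
  exact: nearW.
Qed.

Lemma tc_sub f g : trig_closure f -> trig_closure g -> trig_closure (fun y => f y - g y).
Proof.
move=> tf tg; have -> : (fun y => f y - g y) = (fun y => f y + -1 * g y).
  by apply/funext => y; rewrite mulN1r.
by apply: tc_add => //; exact: tc_scale.
Qed.

Lemma tc_cst k : trig_closure (fun=> k).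
Proof.
have -> : (fun=> k) = (fun y => k * cos (lin_form (fun=> 0) y)).
  apply/funext => y; rewrite (_ : lin_form _ y = 0) ?cos0 ?mulr1//.
  by rewrite /lin_form big1// => i _; rewrite mul0r.
exact/tc_scale/tc_cos.
Qed.

(** Inner induction, on the second factor, of the double induction behind [tc_mul]; the first factor
    will be a cosine or a sine, whence the bound 1. *)
Let tc_mul_gen g : (forall y, `|g y| <= 1) ->
  (forall a, trig_closure (fun y => g y * cos (lin_form a y))) ->
  (forall a, trig_closure (fun y => g y * sin (lin_form a y))) ->
  forall f, trig_closure f -> trig_closure (fun y => g y * f y).
Proof.
move=> g1 gc gs f; elim=> {f} //.
- move=> f1 f2 _ h1 _ h2; under eq_fun do rewrite mulrDr.
  exact: tc_add.
- move=> k f _ h; under eq_fun do rewrite mulrCA.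
  exact: tc_scale.
- move=> u f M _ h uM uf; apply: (@tc_lim _ _ M h) => [n y|y].
    by rewrite normrM -[leRHS]mul1r ler_pM.
  by apply: cvgM => //; exact: cvg_cst.
Qed.

(** Product-to-sum formulas settle two trigonometric factors; limits pass through a product because
    every member of the class is bounded. *)
Lemma tc_mul f g : trig_closure f -> trig_closure g -> trig_closure (fun y => f y * g y).
Proof.
move=> + tg; elim=> {f}.
- move=> a; apply: tc_mul_gen tg.
  + by move=> y; rewrite ler_norml cos_geN1 cos_le1.
  + move=> b; have -> : (fun y => cos (lin_form a y) * cos (lin_form b y)) =
        (fun y => 2^-1 * (cos (lin_form (fun i => a i + b i) y) + cos (lin_form (fun i => a i - b i) y))).
      by apply/funext => y; rewrite lin_formD lin_formB cosD cosB; field.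
    by apply/tc_scale/tc_add; exact: tc_cos.
  + move=> b; have -> : (fun y => cos (lin_form a y) * sin (lin_form b y)) =
        (fun y => 2^-1 * (sin (lin_form (fun i => a i + b i) y) - sin (lin_form (fun i => a i - b i) y))).
      by apply/funext => y; rewrite lin_formD lin_formB sinD sinB; field.
    by apply/tc_scale/tc_sub; exact: tc_sin.
- move=> a; apply: tc_mul_gen tg.
  + by move=> y; rewrite ler_norml sin_geN1 sin_le1.
  + move=> b; have -> : (fun y => sin (lin_form a y) * cos (lin_form b y)) =
        (fun y => 2^-1 * (sin (lin_form (fun i => a i + b i) y) + sin (lin_form (fun i => a i - b i) y))).
      by apply/funext => y; rewrite lin_formD lin_formB sinD sinB; field.
    by apply/tc_scale/tc_add; exact: tc_sin.
  + move=> b; have -> : (fun y => sin (lin_form a y) * sin (lin_form b y)) =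
        (fun y => 2^-1 * (cos (lin_form (fun i => a i - b i) y) - cos (lin_form (fun i => a i + b i) y))).
      by apply/funext => y; rewrite lin_formB lin_formD cosB cosD; field.
    by apply/tc_scale/tc_sub; exact: tc_cos.
- move=> f1 f2 _ h1 _ h2; under eq_fun do rewrite mulrDl.
  exact: tc_add.
- move=> k f _ h; under eq_fun do rewrite -mulrA.
  exact: tc_scale.
- move=> u f M _ h uM uf; have [N gN] := trig_closure_bounded tg.
  apply: (@tc_lim _ _ (M * N) h) => [n y|y]; first by rewrite normrM ler_pM.
  by apply: cvgM => //; exact: cvg_cst.
Qed.

Lemma tc_prod (J : Type) (r : seq J) (P : pred J) (u : J -> (I -> R) -> R) :
  (forall j, trig_closure (u j)) -> trig_closure (fun y => \prod_(j <- r | P j) u j y).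
Proof.
move=> tu; elim: r => [|j r IH].
  by under eq_fun do rewrite big_nil; exact: tc_cst.
under eq_fun do rewrite big_cons.
by case: (P j) => //; exact: tc_mul.
Qed.

(** Two successive limits: iterating [sgstep] turns a sine into its sign, then shrinking the
    argument turns the sign of the sine into that of the form. *)
Lemma tc_sg a h : trig_closure (fun y => Num.sg (lin_form a y - h)).
Proof.
pose v n y := (lin_form a y - h) / n.+1%:R.
have tv n : trig_closure (fun y => sin (v n y)).
  (* The class starts from homogeneous forms, so the threshold [h] is split off by the subtraction
     formula. *)
  have -> : (fun y => sin (v n y)) = (fun y =>
     cos (h / n.+1%:R) * sin (lin_form (fun i => n.+1%:R^-1 * a i) y) -
     sin (h / n.+1%:R) * cos (lin_form (fun i => n.+1%:R^-1 * a i) y)).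
    apply/funext => y; rewrite /v lin_formZ mulrBl sinB.
    by rewrite (mulrC (lin_form a y)); ring.
  apply: tc_sub; apply: tc_scale; [exact: tc_sin|exact: tc_cos].
have sin1 n y : `|sin (v n y)| <= 1 by rewrite ler_norml sin_geN1 sin_le1.
have tsv n : trig_closure (fun y => Num.sg (sin (v n y))).
  apply: (@tc_lim (fun k y => iter k sgstep (sin (v n y))) _ 1).
  - elim=> [|k IH] //=; rewrite /sgstep.
    under eq_fun do rewrite mulrC exprS expr2.
    apply/tc_scale/tc_sub; first exact: tc_scale.
    by do 2 apply: tc_mul => //.
  - by move=> k y; exact: iter_sgstep_le1.
  - by move=> y; exact: cvg_iter_sgstep.
apply: (@tc_lim (fun n y => Num.sg (sin (v n y))) _ 1) => //.
- by move=> n y; rewrite normr_sg; case: eqP.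
- by move=> y; exact: cvg_sg_sin.
Qed.

Lemma tc_ge a h : trig_closure (fun y => (h <= lin_form a y)%R%:R).
Proof.
(* At the sign values 1, 0, -1 the polynomial [1 + (s - s^2) / 2] equals 1, 1, 0, so the boundary
   belongs to the half-space. *)
have -> : (fun y => (h <= lin_form a y)%R%:R) = (fun y =>
    1 + 2^-1 * (Num.sg (lin_form a y - h) -
      Num.sg (lin_form a y - h) * Num.sg (lin_form a y - h))) :> (_ -> R).
  apply/funext => y; rewrite -[h <= _]subr_ge0.
  case: (ltgtP (lin_form a y - h) 0) => h0 /=.
  - by rewrite ltr0_sg//; field.
  - by rewrite gtr0_sg//; field.
  - by rewrite h0 sgr0; ring.
apply: tc_add; first exact: tc_cst.
apply/tc_scale/tc_sub; first exact: tc_sg.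
by apply: tc_mul; exact: tc_sg.
Qed.

Lemma tc_lt a h : trig_closure (fun y => (lin_form a y < h)%R%:R).
Proof.
have -> : (fun y => (lin_form a y < h)%R%:R) = (fun y => 1 - (h <= lin_form a y)%R%:R) :> (_ -> R).
  by apply/funext => y; rewrite ltNge; case: (h <= _) => /=; ring.
apply: tc_sub; [exact: tc_cst|exact: tc_ge].
Qed.

Context d1 d2 (T1 : measurableType d1) (T2 : measurableType d2).
Variables (P1 : probability T1 R) (P2 : probability T2 R).
Variables (Y1 : I -> T1 -> R) (Y2 : I -> T2 -> R).
Hypotheses (mY1 : forall i, measurable_fun setT (Y1 i))
           (mY2 : forall i, measurable_fun setT (Y2 i)).

Lemma measurable_lin_form d (T : measurableType d) (Y : I -> T -> R) a :
  (forall i, measurable_fun setT (Y i)) ->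
  measurable_fun setT (fun w => lin_form a (Y ^~ w)).
Proof. by move=> mY; apply: measurable_sum => i; exact: measurable_funM. Qed.

Lemma measurable_trig_closure d (T : measurableType d) (Y : I -> T -> R) f :
  (forall i, measurable_fun setT (Y i)) ->
  trig_closure f -> measurable_fun setT (fun w => f (Y ^~ w)).
Proof.
move=> mY; elim=> {f}.
- move=> a; apply: measurableT_comp; last exact: measurable_lin_form.
  by apply: continuous_measurable_fun; exact: continuous_cos.
- move=> a; apply: measurableT_comp; last exact: measurable_lin_form.
  by apply: continuous_measurable_fun; exact: continuous_sin.
- by move=> f g _ mf _ mg; exact: measurable_funD.
- by move=> k f _ mf; exact: measurable_funM.
- by move=> u g M _ mu uM ug; apply: measurable_fun_cvg mu _ => w _; exact: ug.
Qed.

Hypothesis eq_cos : forall a, (\int[P1]_w (cos (lin_form a (Y1 ^~ w)))%:E =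
  \int[P2]_w (cos (lin_form a (Y2 ^~ w)))%:E)%E.
Hypothesis eq_sin : forall a, (\int[P1]_w (sin (lin_form a (Y1 ^~ w)))%:E =
  \int[P2]_w (sin (lin_form a (Y2 ^~ w)))%:E)%E.

Lemma integrable_trig_closure d (T : measurableType d) (P : probability T R)
  (Y : I -> T -> R) f : (forall i, measurable_fun setT (Y i)) ->
  trig_closure f -> P.-integrable setT (fun w => (f (Y ^~ w))%:E).
Proof.
move=> mY tf; have [M fM] := trig_closure_bounded tf.
apply: (@measurable_bounded_integrable _ _ _ P (fun w => f (Y ^~ w)) setT) => //.
- by rewrite (le_lt_trans (probability_le1 _ _)) ?ltry.
- exact: measurable_trig_closure.
- exists M; split; first exact: num_real.
  by move=> x Mx w _ /=; rewrite (le_trans (fM _))// ltW.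
Qed.

(** Equality of integrals passes through linear combinations and, by dominated convergence, through
    bounded limits, but not directly through products. This is why products are derived in [tc_mul]
    and are not a constructor. *)
Lemma integral_trig_closure f : trig_closure f ->
  (\int[P1]_w (f (Y1 ^~ w))%:E = \int[P2]_w (f (Y2 ^~ w))%:E)%E.
Proof.
elim=> {f} //.
- move=> f g tf hf tg hg.
  under eq_integral do rewrite EFinD.
  under [in RHS]eq_integral do rewrite EFinD.
  by rewrite !integralD ?hf ?hg//; exact: integrable_trig_closure.
- move=> k f tf hf.
  under eq_integral do rewrite EFinM.
  under [in RHS]eq_integral do rewrite EFinM.
  by rewrite !integralZl ?hf//; exact: integrable_trig_closure.
- move=> u g M tu hu uM ug.
  have lim_int d (T : measurableType d) (P : probability T R) (Y : I -> T -> R) :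
      (forall i, measurable_fun setT (Y i)) ->
    (\int[P]_w (u n (Y ^~ w))%:E @[n --> \oo] --> \int[P]_w (g (Y ^~ w))%:E)%E.
    move=> mY; have [|||||//] := @dominated_convergence _ _ _ P setT measurableT
      (fun n w => (u n (Y ^~ w))%:E) (fun w => (g (Y ^~ w))%:E) (cst M%:E).
    - by move=> n; apply/measurable_EFinP; exact: measurable_trig_closure.
    - apply/measurable_EFinP/measurable_trig_closure => //; exact: tc_lim ug.
    - by apply: aeW => w _; apply/fine_cvgP; split; [exact: nearW|exact: ug].
    - exact: finite_measure_integrable_cst.
    - by apply: aeW => w n _; rewrite lee_fin.
  have := lim_int _ _ P2 _ mY2; rewrite (_ : (fun n => _) =
      (fun n => (\int[P1]_w (u n (Y1 ^~ w))%:E)%E)); last by apply/funext => n; rewrite hu.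
  move/cvg_lim => <- //; apply/esym/cvg_lim => //; exact: lim_int.
Qed.

End trig_closure.

(** Closed half-lines are stable under intersection and generate the Borel sets, so the two
    variables have the same image measure. The integrals may be infinite. *)
Lemma probability_eq_halfline (R : realType) d1 d2 (T1 : measurableType d1)
    (T2 : measurableType d2) (P1 : probability T1 R) (P2 : probability T2 R)
    (Z1 : T1 -> R) (Z2 : T2 -> R) (f : R -> R) :
  measurable_fun setT Z1 -> measurable_fun setT Z2 ->
  (forall m, P1 (Z1 @^-1` `[m, +oo[) = P2 (Z2 @^-1` `[m, +oo[)) ->
  measurable_fun setT f -> (forall x, 0 <= f x) ->
  (\int[P1]_w (f (Z1 w))%:E = \int[P2]_w (f (Z2 w))%:E)%E.
Proof.
move=> mZ1 mZ2 ZE mf f0.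
pose h1 := isMeasurableFun.Build _ _ _ (measurableTypeR R) Z1 mZ1.
pose z1 : {mfun T1 >-> measurableTypeR R} := HB.pack (Z1 : T1 -> measurableTypeR R) h1.
pose h2 := isMeasurableFun.Build _ _ _ (measurableTypeR R) Z2 mZ2.
pose z2 : {mfun T2 >-> measurableTypeR R} := HB.pack (Z2 : T2 -> measurableTypeR R) h2.
have muE A : measurable A -> pushforward P1 z1 A = pushforward P2 z2 A.
  apply: (@measure_unique _ _ (measurableTypeR R) (@RGenCInfty.G R)
    (fun n => `[- n%:R, +oo[%classic)).
  - exact: RGenCInfty.measurableE.
  - move=> _ _ [x ->] [y ->]; exists (Num.max x y); apply/seteqP; split => z /=.
      by rewrite !in_itv/= !andbT ge_max => -[-> ->].
    by rewrite !in_itv/= !andbT ge_max => /andP[].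
  - by move=> n; eexists.
  - rewrite -subTset => x _; exists (Num.truncn (`|x|)).+1 => //=.
    rewrite in_itv/= andbT lerNl (le_trans (ler_norm _))// normrN ltW//.
    by rewrite truncnS_gt.
  - by move=> _ [m ->]; rewrite /pushforward/=; exact: ZE.
  - move=> n; rewrite /pushforward (le_lt_trans (probability_le1 _ _)) ?ltry//.
    rewrite -[_ @^-1` _]setTI; exact: (mZ1 measurableT _ (measurable_itv _)).
have mfE : measurable_fun [set: measurableTypeR R] (fun x => (f x)%:E).
  by apply/measurable_EFinP; exact: mf.
have f0E : {in [set: measurableTypeR R], forall y, (0 <= (f y)%:E)%E}.
  by move=> x _; rewrite lee_fin.
have := @ge0_integral_pushforward _ _ _ _ R _ mZ1 P1 setT _ measurableT mfE f0E.
have := @ge0_integral_pushforward _ _ _ _ R _ mZ2 P2 setT _ measurableT mfE f0E.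
rewrite !preimage_setT => <- <-.
by apply: eq_measure_integral => A mA _; exact: muE.
Qed.

(** * Functions of a linear form on an event *)

Section event_integral.
Context {R : realType} {I : Type}.
Variable s : seq I.
Context d1 d2 (T1 : measurableType d1) (T2 : measurableType d2).
Variables (P1 : probability T1 R) (P2 : probability T2 R).
Variables (Y1 : I -> T1 -> R) (Y2 : I -> T2 -> R).
Hypotheses (mY1 : forall i, measurable_fun setT (Y1 i))
           (mY2 : forall i, measurable_fun setT (Y2 i)).
Hypothesis eq_cos : forall a, (\int[P1]_w (cos (lin_form s a (Y1 ^~ w)))%:E =
  \int[P2]_w (cos (lin_form s a (Y2 ^~ w)))%:E)%E.
Hypothesis eq_sin : forall a, (\int[P1]_w (sin (lin_form s a (Y1 ^~ w)))%:E =
  \int[P2]_w (sin (lin_form s a (Y2 ^~ w)))%:E)%E.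

(* Both sides are compared through the law of [b * lin_form a], whose half-line
   indicators are in [trig_closure]. *)
Lemma integral_event_lin_form (b : (I -> R) -> bool) (a : I -> R) (f : R -> R) :
  trig_closure s (fun y => (b y)%:R) ->
  measurable_fun setT f -> (forall x, 0 <= f x) ->
  (\int[P1]_w ((b (Y1 ^~ w))%:R * f (lin_form s a (Y1 ^~ w)))%:E =
   \int[P2]_w ((b (Y2 ^~ w))%:R * f (lin_form s a (Y2 ^~ w)))%:E)%E.
Proof.
move=> tb mf f0; pose Z (y : I -> R) : R := (b y)%:R * lin_form s a y.
have mb d (T : measurableType d) (Y : I -> T -> R) :
    (forall i, measurable_fun setT (Y i)) ->
    measurable_fun setT (fun w => (b (Y ^~ w))%:R : R).
  by move=> mY; exact: measurable_trig_closure tb.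
have mZ d (T : measurableType d) (Y : I -> T -> R) :
    (forall i, measurable_fun setT (Y i)) ->
    measurable_fun setT (fun w => Z (Y ^~ w)).
  move=> mY; apply: measurable_funM; first exact: mb.
  exact: measurable_lin_form.
have tZ m : trig_closure s (fun y => (m <= Z y)%R%:R).
  (* Off the event [Z] is 0, so there the inequality reads [m <= 0]. *)
  have -> : (fun y => (m <= Z y)%R%:R) = (fun y =>
      (b y)%:R * (m <= lin_form s a y)%R%:R + (m <= 0)%R%:R * (1 - (b y)%:R)) :> (_ -> R).
    by apply/funext => y; rewrite /Z; case: (b y); rewrite ?mul1r ?mul0r/=; ring.
  apply: tc_add; first by apply: tc_mul => //; exact: tc_ge.
  by apply/tc_scale/tc_sub => //; exact: tc_cst.
have tail d (T : measurableType d) (P : probability T R) (Y : I -> T -> R) m :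
    (forall i, measurable_fun setT (Y i)) ->
    (P ((fun w => Z (Y ^~ w)) @^-1` `[m, +oo[) = \int[P]_w ((m <= Z (Y ^~ w))%R%:R)%:E)%E.
  move=> mY; set A := _ @^-1` _.
  have mA : measurable A.
    by rewrite /A -[_ @^-1` _]setTI; apply: mZ => //; exact: measurable_itv.
  rewrite -[A]setIT -integral_indic//; apply: eq_integral => w _.
  rewrite indicE; congr (_%:R)%:E; congr nat_of_bool; apply/idP/idP.
    by rewrite inE /A/= in_itv/= andbT.
  by move=> h; rewrite inE /A/= in_itv/= andbT.
have ZE : (\int[P1]_w (f (Z (Y1 ^~ w)))%:E = \int[P2]_w (f (Z (Y2 ^~ w)))%:E)%E.
  apply: probability_eq_halfline => //; [exact: mZ|exact: mZ|].
  by move=> m; rewrite !tail// (integral_trig_closure mY1 mY2 eq_cos eq_sin (tZ m)).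
(* Off the event [f (Z y)] is [f 0] rather than 0. This surplus is bounded, so its integral is
   finite and can be subtracted even when the other integral is infinite. *)
pose k (y : I -> R) : R := (1 - (b y)%:R) * f 0.
have k0 y : 0 <= k y by rewrite /k mulr_ge0//; case: (b y); rewrite ?subrr ?subr0.
have tk : trig_closure s k.
  rewrite /k; under eq_fun do rewrite mulrC.
  by apply/tc_scale/tc_sub => //; exact: tc_cst.
have split_int d (T : measurableType d) (P : probability T R) (Y : I -> T -> R) :
    (forall i, measurable_fun setT (Y i)) ->
    (\int[P]_w (f (Z (Y ^~ w)))%:E =
     \int[P]_w ((b (Y ^~ w))%:R * f (lin_form s a (Y ^~ w)))%:E + \int[P]_w (k (Y ^~ w))%:E)%E.
  move=> mY; rewrite -ge0_integralD//=.
  - apply: eq_integral => w _; rewrite -EFinD; congr (_%:E); rewrite /Z /k.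
    by case: (b _); rewrite ?mul1r ?mul0r ?subrr ?subr0 ?mul0r ?mul1r ?addr0 ?add0r.
  - by move=> w _; rewrite lee_fin mulr_ge0.
  - apply/measurable_EFinP; apply: measurable_funM; first exact: mb.
    by apply: measurableT_comp => //; exact: measurable_lin_form.
  - by move=> w _; rewrite lee_fin.
  - by apply/measurable_EFinP; exact: (measurable_trig_closure mY tk).
move: ZE; rewrite !split_int// -(integral_trig_closure mY1 mY2 eq_cos eq_sin tk).
have kfin : (\int[P1]_w (k (Y1 ^~ w))%:E)%E \is a fin_num.
  by apply: integrable_fin_num => //; exact: (integrable_trig_closure P1 mY1 tk).
by move/(congr1 (fun z => z - \int[P1]_w (k (Y1 ^~ w))%:E)%E); rewrite !addeK.
Qed.

End event_integral.

(** * The normal distribution *)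

Section normal_shift.
Context {R : realType}.
Notation mu := (@lebesgue_measure R).
Variable s : R.
Hypothesis s0 : s != 0.
Notation N := (normal_prob 0 s).

Let shiftr (t : R) : measurableTypeR R -> measurableTypeR R := fun x => x + t.

Let measurable_shiftr t : measurable_fun setT (shiftr t).
Proof. exact: measurable_funD. Qed.

Let lebesgue_measure_shift (t : R) (A : set R) : measurable A ->
  pushforward mu (shiftr t) A = mu A.
Proof.
pose mft := isMeasurableFun.Build _ _ _ _ _ (measurable_shiftr t).
pose ft : {mfun _ >-> _} := HB.pack (shiftr t) mft.
move=> mA; apply/esym; apply: (@lebesgue_measure_unique _ (pushforward mu ft)) => //=.
move=> _ [[a b]] _ <-.
rewrite /pushforward (_ : _ @^-1` _ = `]a - t, b - t]%classic); last first.
  by apply/seteqP; split => x /=; rewrite !in_itv/= ltrBlDr lerBrDr.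
rewrite !lebesgue_measure_itv/= !lte_fin ltrD2r -!EFinB.
by congr (if _ then _%:E else _); ring.
Qed.

Lemma ge0_integral_shift (t : R) (f : R -> \bar R) :
  measurable_fun setT f -> (forall x, 0 <= f x)%E ->
  (\int[mu]_x f (x + t)%R = \int[mu]_x f x)%E.
Proof.
move=> mf f0.
have := @ge0_integral_pushforward _ _ _ _ R _ (measurable_shiftr t) mu setT f
  measurableT mf (fun x _ => f0 x).
rewrite preimage_setT => <-.
by apply: eq_measure_integral => A mA _ /=; exact: lebesgue_measure_shift.
Qed.

Lemma integral_normal_prob (f : R -> \bar R) : measurable_fun setT f ->
  N.-integrable setT f ->
  (\int[N]_x f x = \int[mu]_x (f x * (normal_pdf 0 s x)%:E))%E.
Proof.
move=> mf intf.
have dom : N `<< mu by exact: normal_prob_dominates.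
rewrite -(Radon_Nikodym_change_of_variables dom)//=.
apply: ae_eq_integral => //.
- apply: emeasurable_funM; first exact: mf.
  apply: (measurable_int mu); exact: Radon_Nikodym_integrable.
- apply: emeasurable_funM; first exact: mf.
  apply/measurable_EFinP.
  exact: measurable_normal_pdf.
- apply: ae_eqe_mul2l => /=.
  rewrite Radon_NikodymE//=.
  case: cid => /= h [h1 h2 h3].
  apply: integral_ae_eq => //=.
  + by apply/measurable_EFinP; exact: measurable_normal_pdf.
  + by move=> E E01 mE; rewrite -h3.
Qed.

(** Truncation at [n] gives bounded, hence integrable, functions; monotone convergence removes it
    and lets infinite integrals through. *)
Lemma ge0_integral_normal_prob (f : R -> R) : measurable_fun setT f ->
  (forall x, 0 <= f x) ->
  (\int[N]_x (f x)%:E = \int[mu]_x (f x * normal_pdf 0 s x)%:E)%E.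
Proof.
move=> mf f0.
pose g n x := Num.min (f x) n%:R.
have g0 n x : 0 <= g n x by rewrite le_min f0 ler0n.
have mg n : measurable_fun setT (g n) by exact: measurable_minr.
have nd x : nondecreasing_seq (g ^~ x).
  by move=> m n mn; rewrite le_min ge_min lexx/= ge_min ler_nat mn orbT.
have gf x : g n x @[n --> \oo] --> f x.
  apply: cvg_near_cst; near=> n; apply/min_idPl.
  by near: n; exact: nbhs_infty_ger.
have gN n : (\int[N]_x (g n x)%:E = \int[mu]_x (g n x * normal_pdf 0 s x)%:E)%E.
  apply: integral_normal_prob; first exact/measurable_EFinP.
  apply: (@measurable_bounded_integrable _ _ _ N (g n) setT) => //.
  - by rewrite (le_lt_trans (probability_le1 _ _)) ?ltry.
  - exact: mg.
  exists n%:R; split; first exact: num_real.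
  move=> x nx y _ /=; rewrite ger0_norm// (le_trans _ (ltW nx))//.
  by rewrite ge_min lexx orbT.
transitivity (limn (fun n => \int[N]_x (g n x)%:E)%E).
  rewrite -monotone_convergence//.
  - apply: eq_integral => x _; apply/esym/cvg_lim => //.
    by apply/fine_cvgP; split; [exact: nearW|exact: gf].
  - by move=> n; apply/measurable_EFinP; exact: mg.
  - by move=> n x _; rewrite lee_fin.
  - by move=> x _ m n mn; rewrite lee_fin; exact: nd.
under eq_fun do rewrite gN.
rewrite -monotone_convergence//.
- apply: eq_integral => x _; apply/cvg_lim => //.
  apply/fine_cvgP; split; first exact: nearW.
  by apply: cvgM; [exact: gf|exact: cvg_cst].
- move=> n; apply/measurable_EFinP; apply: measurable_funM; first exact: mg.
  exact: measurable_normal_pdf.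
- by move=> n x _; rewrite lee_fin mulr_ge0// normal_pdf_ge0.
- move=> x _ m n mn; rewrite lee_fin ler_wpM2r ?normal_pdf_ge0//; exact: nd.
Unshelve. all: by end_near. Qed.

Lemma normal_pdf_shift t x : normal_pdf 0 s (x + t) =
  expR (- (t * x + t ^+ 2 / 2) / s ^+ 2) * normal_pdf 0 s x.
Proof.
rewrite !normal_pdfE// mulrCA; congr (_ * _).
rewrite /normal_fun -expRD; congr expR; rewrite -mulr_natr; field.
exact: s0.
Qed.

(** The Cameron-Martin formula on the line, from the translation invariance of Lebesgue measure. *)
Lemma normal_prob_shift (g : R -> R) t : measurable_fun setT g ->
  (forall x, 0 <= g x) ->
  (\int[N]_x (expR (- (t * x + t ^+ 2 / 2) / s ^+ 2) * g x)%:E =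
   \int[N]_x (g (x - t))%:E)%E.
Proof.
move=> mg g0.
have mw : measurable_fun setT (fun x : R => expR (- (t * x + t ^+ 2 / 2) / s ^+ 2)).
  apply: measurableT_comp => //; apply: measurable_funM => //.
  by apply: measurableT_comp => //; exact: measurable_funD.
rewrite (ge0_integral_normal_prob (measurable_funM mw mg)); last first.
  by move=> x; rewrite /= mulr_ge0 ?expR_ge0.
rewrite (@ge0_integral_normal_prob (fun x => g (x - t))); last 2 first.
- by apply: measurableT_comp => //; exact: measurable_funB.
- by move=> x; exact: g0.
rewrite -(@ge0_integral_shift t (fun x => (g (x - t) * _)%:E)); last 2 first.
- apply/measurable_EFinP; apply: measurable_funM; last exact: measurable_normal_pdf.
  by apply: measurableT_comp => //; exact: measurable_funB.
- by move=> x; rewrite lee_fin mulr_ge0 ?normal_pdf_ge0.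
by apply: eq_integral => x _; rewrite addrK normal_pdf_shift mulrAC mulrC.
Qed.

End normal_shift.

Lemma is_derive_under_integral (R : realType) d (Y : measurableType d)
    (m : {measure set Y -> \bar R}) (f df : R -> Y -> R) (a e : R) (G : Y -> R) :
  0 < e ->
  (forall x, `|x - a| < e -> m.-integrable setT (EFin \o f x)) ->
  (forall x y, `|x - a| < e -> is_derive x 1 (f ^~ y) (df x y)) ->
  m.-integrable setT (EFin \o G) ->
  (forall x y, `|x - a| < e -> `|df x y| <= G y) ->
  is_derive a 1 (fun x => \int[m]_y f x y) (\int[m]_y df a y).
Proof.
move=> e0 intf dfE intG dfG.
have ae : `]a - e, a + e[%classic a by rewrite /= in_itv/=; apply/andP; split; lra.
have near_a x : `]a - e, a + e[%classic x -> `|x - a| < e.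
  by rewrite /= in_itv/= ltr_distl.
have a_e : `|a - a| < e by rewrite subrr normr0.
have intf' x : `]a - e, a + e[%classic x -> m.-integrable setT (EFin \o f x).
  by move=> /near_a; exact: intf.
have derf x y : `]a - e, a + e[%classic x -> setT y -> derivable (f ^~ y) x 1.
  by move=> /near_a/(dfE x y)[].
have d1E x y : `]a - e, a + e[%classic x -> partial1of2 f x y = df x y.
  by move=> /near_a/(dfE x y) fxy; rewrite partial1of2E derive_val.
have G0 y : 0 <= G y by rewrite (le_trans _ (dfG a y a_e)).
have dG x y : `]a - e, a + e[%classic x -> setT y -> `|partial1of2 f x y| <= G y.
  by move=> xa _; rewrite d1E//; exact/dfG/near_a.
apply: DeriveDef.
  exact: (derivable_under_integral measurableT ae intf' derf G0 intG dG).
rewrite -derive1E (differentiation_under_integral measurableT ae intf' derf G0 intG dG).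
by apply: eq_Rintegral => y _; rewrite d1E.
Qed.

(** * Exponential moments and characteristic function of the normal distribution *)

Section normal_char.
Context {R : realType}.
Variable s : R.
Hypothesis s0 : s != 0.
Notation N := (normal_prob 0 s).

Let weight t x := expR (- (t * x + t ^+ 2 / 2) / s ^+ 2).

Let measurable_weight t : measurable_fun setT (weight t).
Proof.
apply: measurableT_comp => //; apply: measurable_funM => //.
by apply: measurableT_comp => //; exact: measurable_funD.
Qed.

Lemma integral_normal_expR k :
  (\int[N]_x (expR (k * x))%:E = (expR (k ^+ 2 * s ^+ 2 / 2))%:E)%E.
Proof.
(* With this shift the weight is [exp (k x - k^2 s^2 / 2)]. *)
have := @normal_prob_shift R s s0 (cst 1) (- k * s ^+ 2) (measurable_cst _) (fun _ => ler01).
have -> : (\int[N]_x (cst 1 (x - - k * s ^+ 2))%:E = 1)%E.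
  rewrite (eq_integral (cst 1%E))// integral_cst// mul1e; exact: probability_setT.
move=> e1; rewrite -[RHS]mule1 -e1 -ge0_integralZl_EFin//=; last first.
  by apply/measurable_EFinP/measurable_funM => //; exact: measurable_weight.
apply: eq_integral => x _; rewrite -EFinM mulr1 -expRD; congr (expR _)%:E.
by field.
Qed.

Lemma integrable_normal_expR k : N.-integrable setT (fun x => (expR (k * x))%:E).
Proof.
apply/integrableP; split.
  by apply/measurable_EFinP; apply: measurableT_comp => //; exact: measurable_funM.
under eq_integral do rewrite gee0_abs ?lee_fin ?expR_ge0//.
by rewrite integral_normal_expR ltry.
Qed.

Lemma integrable_normal_expR_norm k :
  N.-integrable setT (fun x => (expR (k * `|x|))%:E).
Proof.
apply: (@le_integrable _ _ _ N setT measurableT _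
    (fun x => (expR (k * x))%:E + (expR (- k * x))%:E)%E).
- apply/measurable_EFinP; apply: measurableT_comp => //.
  by apply: measurable_funM => //; exact: measurableT_comp.
- move=> x _; rewrite -EFinD !abse_EFin lee_fin.
  rewrite (ger0_norm (expR_ge0 _)) (ger0_norm (addr_ge0 (expR_ge0 _) (expR_ge0 _))).
  have [x0|x0] := leP (0 : R) x; first by rewrite ger0_norm// lerDl expR_ge0.
  by rewrite ltr0_norm// mulrN -mulNr lerDr expR_ge0.
- by apply: integrableD => //; exact: integrable_normal_expR.
Qed.

Let norm_le_expR (x : R) : `|x| + 1 <= expR (1 * `|x|).
Proof. by rewrite mul1r addrC expR_ge1Dx. Qed.

Let phase_measurable (tau th : R) : measurable_fun setT (fun x : R => tau * x + th).
Proof. by apply: measurable_funD => //; exact: measurable_funM. Qed.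

Let cos_measurable tau th : measurable_fun setT (fun x : R => cos (tau * x + th)).
Proof.
apply: measurableT_comp (phase_measurable _ _).
by apply: continuous_measurable_fun; exact: continuous_cos.
Qed.

Let sin_measurable tau th : measurable_fun setT (fun x : R => sin (tau * x + th)).
Proof.
apply: measurableT_comp (phase_measurable _ _).
by apply: continuous_measurable_fun; exact: continuous_sin.
Qed.

Let bounded_integrable (f : R -> R) : measurable_fun setT f ->
  (forall x, `|f x| <= 1) -> N.-integrable setT (EFin \o f).
Proof.
move=> mf f1; apply: measurable_bounded_integrable => //.
- by rewrite (le_lt_trans (probability_le1 _ _)) ?ltry.
- exists 1; split; first exact: num_real.
  by move=> x x1 y _ /=; rewrite (le_trans (f1 _))// ltW.
Qed.

Let cos_integrable tau th : N.-integrable setT (EFin \o (fun x : R => cos (tau * x + th))).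
Proof.
by apply: bounded_integrable => // x; rewrite ler_norml cos_geN1 cos_le1.
Qed.

Let sin_integrable tau th : N.-integrable setT (EFin \o (fun x : R => sin (tau * x + th))).
Proof.
by apply: bounded_integrable => // x; rewrite ler_norml sin_geN1 sin_le1.
Qed.

Let weight_integrable t : N.-integrable setT (EFin \o weight t).
Proof.
apply: (@eq_integrable _ _ _ N setT measurableT
  (fun x => (expR (- (t ^+ 2 / 2) / s ^+ 2))%:E * (expR (- t / s ^+ 2 * x))%:E)%E).
  move=> x _; rewrite /= -EFinM -expRD; congr (expR _)%:E; field; exact: s0.
by apply: integrableZl => //; exact: integrable_normal_expR.
Qed.

Let weight_sin_integrable t tau th :
  N.-integrable setT (EFin \o (fun x => weight t x * sin (tau * x + th))).
Proof.
apply: (@le_integrable _ _ _ N setT measurableT _ (EFin \o weight t)) => //.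
- apply/measurable_EFinP; apply: measurable_funM; first exact: measurable_weight.
  exact: sin_measurable.
- move=> x _; rewrite /= lee_fin normrM -[leRHS]mulr1 ler_wpM2l//.
  by rewrite ler_norml sin_geN1 sin_le1.
Qed.

Let shift_sin t tau th :
  \int[N]_x (weight t x * sin (tau * x + th)) = \int[N]_x sin (tau * (x - t) + th).
Proof.
(* [normal_prob_shift] is about nonnegative functions: 1 is added to the sine, and its contribution
   cancels by [E0]. *)
have msh : measurable_fun setT (fun x => 1 + sin (tau * x + th)).
  by apply: measurable_funD => //; exact: sin_measurable.
have sh0 x : 0 <= 1 + sin (tau * x + th) by rewrite -lerBlDl sub0r sin_geN1.
have E1 : \int[N]_x (weight t x * (1 + sin (tau * x + th))) =
    \int[N]_x (1 + sin (tau * (x - t) + th)).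
  by rewrite /Rintegral (normal_prob_shift s0 t msh sh0).
have E0 : \int[N]_x weight t x = \int[N]_x (1 : R).
  rewrite /Rintegral -(@normal_prob_shift R s s0 (cst 1) t (measurable_cst _) (fun _ => ler01)).
  by under [in RHS]eq_integral do rewrite mulr1.
have sE : (fun x : R => sin (tau * (x - t) + th)) = (fun x => sin (tau * x + (th - tau * t))).
  by apply/funext => x; congr sin; ring.
have intc : N.-integrable setT (EFin \o cst (1 : R)).
  by apply: bounded_integrable => // x; rewrite normr1.
move: E1; under [in LHS]eq_Rintegral do rewrite mulrDr mulr1.
have ints : N.-integrable setT (EFin \o (fun x : R => sin (tau * (x - t) + th))).
  by rewrite sE; exact: sin_integrable.
rewrite RintegralD//= E0 RintegralD//.
by move/addrI.
Qed.

Let id_integrable : N.-integrable setT (EFin \o (fun x : R => `|x|)).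
Proof.
apply: le_integrable (integrable_normal_expR_norm 1) => //.
- by apply/measurable_EFinP; exact: measurableT_comp.
- move=> x _; rewrite /= lee_fin normr_id (ger0_norm (expR_ge0 _)).
  by rewrite (le_trans _ (norm_le_expR x))// lerDl.
Qed.

(* Obtained by differentiating [shift_sin] at [t = 0]. *)
Let by_parts tau th :
  \int[N]_x (x * sin (tau * x + th)) = s ^+ 2 * tau * \int[N]_x cos (tau * x + th).
Proof.
pose f t x := weight t x * sin (tau * x + th).
pose df t x := (- (x + t) / s ^+ 2) * weight t x * sin (tau * x + th).
pose g t x := sin (tau * (x - t) + th).
pose dg t x := - tau * cos (tau * (x - t) + th).
have s2 : 0 < s ^+ 2 by rewrite exprn_even_gt0.
have Df : is_derive (0 : R) (1 : R) (fun t => \int[N]_x f t x) (\int[N]_x df 0 x).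
  (* For [|t| < 1] the factor [|x + t|] is at most [exp |x|] and the weight at most
     [exp ((1 + |x|) / s^2)]. *)
  apply: (@is_derive_under_integral R _ _ N f df 0 1
      (fun x => (expR (1 / s ^+ 2)) / s ^+ 2 * (expR ((1 + (s ^+ 2)^-1) * `|x|)))) => //.
  - by move=> t _; exact: weight_sin_integrable.
  - move=> t x _.
    have -> : f ^~ x = (fun t => expR (- (t * x + t ^+ 2 / 2) / s ^+ 2) * sin (tau * x + th)).
      by [].
    by apply: is_derive_eq; rewrite /df /weight /GRing.scale/=; field.
  - have -> : EFin \o (fun x : R => expR (1 / s ^+ 2) / s ^+ 2 *
        expR ((1 + (s ^+ 2)^-1) * `|x|)) = (fun x : R => (expR (1 / s ^+ 2) / s ^+ 2)%:E *
        (expR ((1 + (s ^+ 2)^-1) * `|x|))%:E)%E by [].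
    by apply: integrableZl => //; exact: integrable_normal_expR_norm.
  - move=> t x; rewrite subr0 => t1; rewrite /df !normrM.
    rewrite -[leRHS]mulr1; apply: ler_pM => //.
      rewrite normfV normrN (gtr0_norm s2) (ger0_norm (expR_ge0 _)).
      rewrite mulrAC [leRHS]mulrAC ler_pM2r ?invr_gt0//.
      rewrite mulrDl mul1r expRD mulrCA; apply: ler_pM => //.
      + rewrite (le_trans _ (norm_le_expR _))//.
        by rewrite (le_trans (ler_normD _ _))// lerD2l ltW.
      + rewrite -expRD ler_expR.
        have -> : s ^- 2 + s ^- 2 * `|x| = s ^- 2 * (1 + `|x|) by rewrite mulrDr mulr1.
        rewrite mulrC ler_pM2l ?invr_gt0//.
        have : - (t * x) <= `|x|.
          rewrite (le_trans (ler_norm _))// normrN normrM ler_piMl//; exact: ltW.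
        have := sqr_ge0 t; lra.
    by rewrite ler_norml sin_geN1 sin_le1.
have Dg : is_derive (0 : R) (1 : R) (fun t => \int[N]_x g t x) (\int[N]_x dg 0 x).
  have gE t : g t = (fun x => sin (tau * x + (th - tau * t))).
    by apply/funext => x; congr sin; ring.
  apply: (@is_derive_under_integral R _ _ N g dg 0 1 (cst `|tau|)) => //.
  - move=> t _; rewrite gE; exact: sin_integrable.
  - move=> t x _.
    have -> : g ^~ x = (sin \o (fun t => tau * (x - t) + th)) by [].
    by apply: is_derive_eq; rewrite /dg /GRing.scale/=; ring.
  - exact: finite_measure_integrable_cst.
  - move=> t x _; rewrite /dg normrM normrN ler_piMr//.
    by rewrite ler_norml cos_geN1 cos_le1.
have fg : (fun t => \int[N]_x f t x) = (fun t => \int[N]_x g t x).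
  by apply/funext => t; exact: shift_sin.
have := @derive_val _ _ _ _ _ _ _ Df; rewrite fg (@derive_val _ _ _ _ _ _ _ Dg).
rewrite (_ : \int[N]_x dg 0 x = - tau * \int[N]_x cos (tau * x + th)); last first.
  rewrite -RintegralZl//.
  by apply: eq_Rintegral => x _; rewrite /dg subr0.
rewrite (_ : \int[N]_x df 0 x = (- (s ^+ 2)^-1) * \int[N]_x (x * sin (tau * x + th))); last first.
  rewrite -RintegralZl//; last first.
    apply: le_integrable id_integrable => //.
    - apply/measurable_EFinP; apply: measurable_funM => //; exact: sin_measurable.
    - move=> x _; rewrite /= lee_fin normrM normr_id ler_piMr//.
      by rewrite ler_norml sin_geN1 sin_le1.
  apply: eq_Rintegral => x _; rewrite /df /weight addr0 mul0r add0r expr0n/=.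
  by rewrite !mul0r oppr0 mul0r expR0; ring.
move=> e; apply: (mulfI (x := - (s ^+ 2)^-1)).
  by rewrite oppr_eq0 invr_eq0 gt_eqF.
by rewrite -e; field; exact: s0.
Qed.

(** By [by_parts] the integral solves [C' = - s^2 tau C] in [tau], so its product with
    [exp (s^2 tau^2 / 2)] is constant. The phase [th] will carry the part of a linear form that does
    not involve the normal variable. *)
Lemma integral_normal_cos tau th :
  (\int[N]_x (cos (tau * x + th))%:E = (expR (- (s ^+ 2 * tau ^+ 2 / 2)) * cos th)%:E)%E.
Proof.
pose C t := \int[N]_x cos (t * x + th).
have DC (t : R) : is_derive t (1 : R) C (- s ^+ 2 * t * C t).
  have -> : - s ^+ 2 * t * C t = \int[N]_x (- x * sin (t * x + th)).
    rewrite /C !mulNr -by_parts -mulN1r -RintegralZl//; last first.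
      apply: le_integrable id_integrable => //.
      - apply/measurable_EFinP; apply: measurable_funM => //; exact: sin_measurable.
      - move=> x _; rewrite /= lee_fin normrM normr_id ler_piMr//.
        by rewrite ler_norml sin_geN1 sin_le1.
    by apply: eq_Rintegral => x _; rewrite mulN1r mulNr.
  apply: (@is_derive_under_integral R _ _ N (fun t x => cos (t * x + th))
    (fun t x => - x * sin (t * x + th)) t 1 (fun x => `|x|)) => //.
  - move=> u x _.
    have -> : (fun u => cos (u * x + th)) = (cos \o (fun u => u * x + th)) by [].
    by apply: is_derive_eq; rewrite /GRing.scale/=; ring.
  - move=> u x _; rewrite normrM normrN ler_piMr//.
    by rewrite ler_norml sin_geN1 sin_le1.
pose E t := C t * expR (s ^+ 2 * t ^+ 2 / 2).
have DE (t : R) : is_derive t (1 : R) E 0.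
  have -> : E = (C * (expR \o (fun t => s ^+ 2 * t ^+ 2 / 2)))%R by [].
  by apply: is_derive_eq; rewrite /GRing.scale/=; field.
have := @is_derive_0_is_cst _ E tau 0 DE; rewrite /E expr0n/= mulr0 mul0r expR0 mulr1.
have -> : C 0 = cos th.
  rewrite /C; under eq_Rintegral do rewrite mul0r add0r.
  rewrite Rintegral_cst// (_ : fine _ = 1) ?mulr1//.
  exact: (congr1 fine (@probability_setT _ _ _ N)).
move=> e; rewrite -e mulrCA -expRD addNr expR0 mulr1 /C /Rintegral fineK//.
by apply: integrable_fin_num => //; exact: cos_integrable.
Qed.

End normal_char.

(** * Expansion of a Gaussian exponential *)

Section expR_quadratic_series.
Context {R : realType}.
Implicit Types (x y t : R) (n N : nat).

(** The coefficient of [t^n] in [exp (t x + t^2 y)], that is [H_n(x, y) / n!] for the two-variable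
    Hermite polynomial. The guard excludes the [j] for which the subtraction in [nat] would be
    truncated. *)
Definition expR2_coef x y n : R :=
  \sum_(j < n.+1 | (j.*2 <= n)%N) exp_coeff y j * exp_coeff x (n - j.*2)%N.

(** The partial sums regrouped by powers of [y]; for [N <= 2j] the inner series is empty. *)
Let partial x y N : R := \sum_(j < N) exp_coeff y j * series (exp_coeff x) (N - j.*2)%N.

Let sum_coef x y N : \sum_(n < N) expR2_coef x y n = partial x y N.
Proof.
elim: N => [|N IH]; first by rewrite /partial !big_ord0.
rewrite big_ord_recr/= IH.
have -> : partial x y N =
    \sum_(j < N.+1) exp_coeff y j * series (exp_coeff x) (N - j.*2)%N.
  rewrite big_ord_recr/= (_ : (N - N.*2 = 0)%N); last first.
    by apply/eqP; rewrite subn_eq0 -addnn leq_addr.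
  by rewrite /series/= big_nil mulr0 addr0.
rewrite /expR2_coef [X in _ + X]big_mkcond -big_split/=; apply: eq_bigr => j _.
case: ifPn => jN; first by rewrite subSn// /series/= big_nat_recr//= mulrDr.
have e0 k : (k <= N.+1)%N -> (k - j.*2 = 0)%N.
  by move=> kN; apply/eqP; rewrite subn_eq0 (leq_trans kN)// ltnNge.
by rewrite addr0 !e0.
Qed.

Lemma expR2_coefZ t x y n :
  expR2_coef (t * x) (t ^+ 2 * y) n = t ^+ n * expR2_coef x y n.
Proof.
rewrite /expR2_coef big_distrr/=; apply: eq_bigr => j jn.
have tj : (t ^+ 2) ^+ j = t ^+ j.*2 by rewrite -exprM mul2n.
rewrite /exp_coeff/= [(t ^+ 2 * y) ^+ j]exprMn [(t * x) ^+ _]exprMn tj.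
rewrite -[X in _ = t ^+ X * _](subnK jn) exprD; ring.
Qed.

Let series_ge0 x N : 0 <= x -> 0 <= series (exp_coeff x) N.
Proof. by move=> x0; apply: sumr_ge0 => i _; exact: exp_coeff_ge0. Qed.

Let series_le x N : 0 <= x -> series (exp_coeff x) N <= expR x.
Proof.
move=> x0; apply: nondecreasing_cvgn_le; last exact: is_cvg_series_exp_coeff.
apply/nondecreasing_seqP => n; rewrite /series/= big_nat_recr//= lerDl.
exact: exp_coeff_ge0.
Qed.

Let series_mono x m n : 0 <= x -> (m <= n)%N ->
  series (exp_coeff x) m <= series (exp_coeff x) n.
Proof.
move=> x0; apply: (homo_leq (f := series (exp_coeff x)) (r := <=%R)) => //.
  by move=> a b c; exact: le_trans.
move=> k; rewrite /series/= big_nat_recr//= lerDl; exact: exp_coeff_ge0.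
Qed.

Let norm_coeff x n : `|exp_coeff x n| = exp_coeff `|x| n.
Proof. by rewrite /exp_coeff normrM normrX normfV normr_nat. Qed.

Let norm_series x N : `|series (exp_coeff x) N| <= series (exp_coeff `|x|) N.
Proof.
rewrite /series/= (le_trans (ler_norm_sum _ _ _))// ler_sum// => i _.
by rewrite norm_coeff.
Qed.

Let partial_le x y N : 0 <= x -> 0 <= y -> partial x y N <= expR x * expR y.
Proof.
move=> x0 y0; apply: (@le_trans _ _ (\sum_(j < N) exp_coeff y j * expR x)).
  by apply: ler_sum => j _; rewrite ler_wpM2l ?exp_coeff_ge0// series_le.
rewrite -big_distrl/= mulrC ler_wpM2l ?expR_ge0//.
by have := series_le N y0; rewrite /series/= big_mkord.
Qed.

Let norm_partial x y N : `|partial x y N| <= partial `|x| `|y| N.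
Proof.
rewrite (le_trans (ler_norm_sum _ _ _))// ler_sum// => j _.
by rewrite normrM norm_coeff ler_wpM2l// exp_coeff_ge0.
Qed.

Let norm_coef x y n : `|expR2_coef x y n| <= expR2_coef `|x| `|y| n.
Proof.
rewrite (le_trans (ler_norm_sum _ _ _))// ler_sum// => j _.
by rewrite normrM !norm_coeff.
Qed.

Lemma expR2_partial_le t x y N :
  `|\sum_(n < N) t ^+ n * expR2_coef x y n| <= expR (`|t| * `|x| + t ^+ 2 * `|y|).
Proof.
under eq_bigr do rewrite -expR2_coefZ.
rewrite sum_coef (le_trans (norm_partial _ _ _))// expRD [ `|t * x|]normrM [ `|_ ^+ 2 * y|]normrM.
rewrite (ger0_norm (sqr_ge0 t)) partial_le//.
by rewrite mulr_ge0// sqr_ge0.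
Qed.

(** After passing to absolute values, a term is at most any partial sum that contains it, hence has
    the same majorant. *)
Lemma expR2_term_le t x y n :
  `|t ^+ n * expR2_coef x y n| <= expR (`|t| * `|x| + t ^+ 2 * `|y|).
Proof.
rewrite -expR2_coefZ (le_trans (norm_coef _ _ _))// [ `|t * x|]normrM [ `|_ ^+ 2 * y|]normrM.
rewrite (ger0_norm (sqr_ge0 t)).
have x0 : 0 <= `|t| * `|x| by rewrite mulr_ge0.
have y0 : 0 <= t ^+ 2 * `|y| by rewrite mulr_ge0// sqr_ge0.
rewrite expRD (le_trans _ (partial_le n.+1 x0 y0))// -sum_coef big_ord_recr/= lerDr.
by apply: sumr_ge0 => i _; apply: sumr_ge0 => j _; rewrite mulr_ge0 ?exp_coeff_ge0.
Qed.

Let partial_cvg_ge0 x y : 0 <= x -> 0 <= y ->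
  partial x y N @[N --> \oo] --> expR x * expR y.
Proof.
move=> x0 y0.
have nd : nondecreasing_seq (partial x y).
  apply/nondecreasing_seqP => n; rewrite -!sum_coef big_ord_recr/= lerDl.
  by apply: sumr_ge0 => j _; rewrite mulr_ge0 ?exp_coeff_ge0.
have cv : cvgn (partial x y).
  apply: nondecreasing_is_cvgn => //; exists (expR x * expR y) => _ [n _ <-].
  exact: partial_le.
suff -> : expR x * expR y = limn (partial x y) by [].
apply/eqP; rewrite eq_le; apply/andP; split; last first.
  by apply: limr_le => //; apply: nearW => n; exact: partial_le.
have h : series (exp_coeff x) n * series (exp_coeff y) n @[n --> \oo] --> expR x * expR y.
  by apply: cvgM; exact: is_cvg_series_exp_coeff.
rewrite -(cvg_lim _ h)//; apply: limr_le; first by apply/cvg_ex; eexists; exact: h.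
(* In the partial sum of order [3n] every [j < n] keeps an inner series of order [3n - 2j >= n], so
   this sum dominates the product of the two exponentials truncated at [n]. *)
apply: nearW => n; apply: le_trans (nondecreasing_cvgn_le nd cv (n + n.*2)).
rewrite /partial big_split_ord/= -[leLHS]addr0 lerD//; last first.
  by apply: sumr_ge0 => j _; rewrite mulr_ge0 ?exp_coeff_ge0 ?series_ge0.
rewrite {2}/series/= big_mkord mulrC big_distrl/=; apply: ler_sum => j _.
rewrite ler_wpM2l ?exp_coeff_ge0// series_mono// -addnBA ?leq_addr//.
by rewrite leq_double ltnW.
Qed.

Let tail_le x N : `|expR x - series (exp_coeff x) N| <= expR `|x| - series (exp_coeff `|x|) N.
Proof.
have h1 : `|series (exp_coeff x) n - series (exp_coeff x) N| @[n --> \oo] -->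
    `|expR x - series (exp_coeff x) N|.
  by apply: cvg_norm; apply: cvgB; [exact: is_cvg_series_exp_coeff|exact: cvg_cst].
have h2 : series (exp_coeff `|x|) n - series (exp_coeff `|x|) N @[n --> \oo] -->
    expR `|x| - series (exp_coeff `|x|) N.
  by apply: cvgB; [exact: is_cvg_series_exp_coeff|exact: cvg_cst].
rewrite -(cvg_lim _ h1)// -(cvg_lim _ h2)//; apply: ler_lim.
- by apply/cvg_ex; eexists; exact: h1.
- by apply/cvg_ex; eexists; exact: h2.
near=> n.
have Nn : (N <= n)%N by near: n; exact: nbhs_infty_ge.
rewrite !sub_series_geq// (le_trans (ler_norm_sum _ _ _))// ler_sum// => i _.
by rewrite norm_coeff.
Unshelve. all: by end_near. Qed.

(** The difference with [exp x] times the truncated [exp y] is bounded termwise by the same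
    difference at absolute values, which tends to 0 by the nonnegative case. *)
Lemma expR2_series t x y :
  \sum_(n < N) t ^+ n * expR2_coef x y n @[N --> \oo] --> expR (t * x + t ^+ 2 * y).
Proof.
have coefE N : \sum_(n < N) t ^+ n * expR2_coef x y n = partial (t * x) (t ^+ 2 * y) N.
  by rewrite -sum_coef; apply: eq_bigr => n _; rewrite expR2_coefZ.
under eq_fun do rewrite coefE; rewrite expRD.
move: (t * x) (t ^+ 2 * y) => {coefE t}{}x {}y.
have cS z : series (exp_coeff z) n @[n --> \oo] --> expR z by exact: is_cvg_series_exp_coeff.
pose D N := series (exp_coeff `|y|) N * expR `|x| - partial `|x| `|y| N.
have D0 : D N @[N --> \oo] --> 0.
  rewrite [X in _ --> X](_ : _ = expR `|y| * expR `|x| - expR `|x| * expR `|y|); last by ring.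
  apply: cvgB; last exact: partial_cvg_ge0.
  by apply: cvgM; [exact: cS|exact: cvg_cst].
have dN N : `|series (exp_coeff y) N * expR x - partial x y N| <= D N.
  rewrite /D /partial /series/= !big_mkord !big_distrl/= -!sumrB.
  rewrite (le_trans (ler_norm_sum _ _ _))// ler_sum// => j _.
  by rewrite -!mulrBr normrM norm_coeff ler_wpM2l ?exp_coeff_ge0//; exact: tail_le.
have d0 : series (exp_coeff y) N * expR x - partial x y N @[N --> \oo] --> 0.
  apply/norm_cvg0P; apply: (@squeeze_cvgr _ _ _ _ (cst 0) D) => //.
  - by apply: nearW => n; rewrite normr_ge0 dN.
  - exact: cvg_cst.
have -> : expR x * expR y = expR y * expR x - 0 by ring.
have -> : partial x y = (fun N => series (exp_coeff y) N * expR x -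
    (series (exp_coeff y) N * expR x - partial x y N)).
  by apply/funext => N; rewrite subKr.
apply: cvgB => //; apply: cvgM; [exact: cS|exact: cvg_cst].
Qed.

End expR_quadratic_series.

(** * Equilibrium measure and capacity *)

Lemma cvg_sumr (R : realType) (J : Type) (r : seq J) (u : J -> nat -> R) (l : J -> R) :
  (forall j, u j n @[n --> \oo] --> l j) ->
  \sum_(j <- r) u j n @[n --> \oo] --> \sum_(j <- r) l j.
Proof.
move=> ul; elim: r => [|j r IH].
  by under eq_fun do rewrite big_nil; rewrite big_nil; exact: cvg_cst.
by under eq_fun do rewrite big_cons; rewrite big_cons; exact: cvgD.
Qed.

Section potential_theory.
Variables (V : choiceType) (nbrs : V -> seq V) (R : realType).
Hypothesis Hgraph : simple_locally_finite_graph nbrs.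
Hypothesis Hdeg : forall x, (0 < deg nbrs x)%N.
Notation p := (srw_prob nbrs R).
Notation d x := ((deg nbrs x)%:R : R).

Let d_gt0 x : 0 < d x. Proof. by rewrite ltr0n. Qed.
Let d_neq0 x : d x != 0. Proof. by rewrite gt_eqF. Qed.

Lemma adjC x y : (y \in nbrs x) = (x \in nbrs y).
Proof. by case: Hgraph => + _ _; apply. Qed.

Lemma sum_delta (s : seq V) (y : V) (f : V -> R) : uniq s ->
  \sum_(z <- s) (y == z)%:R * f z = (y \in s)%:R * f y.
Proof.
move=> us; have [ys|ys] := boolP (y \in s).
  rewrite (bigD1_seq y)//= eqxx big1 ?addr0// => z zy.
  by rewrite eq_sym (negPf zy) mul0r.
rewrite mul0r big_seq big1// => z zs.
by have [yz|] := eqVneq y z; [rewrite yz zs in ys|rewrite mul0r].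
Qed.

Lemma srw_prob_ge0 n x y : 0 <= p n x y.
Proof.
elim: n x => [|n IH] x /=; first by rewrite ler0n.
by rewrite mulr_ge0 ?invr_ge0// sumr_ge0.
Qed.

(** The definition of [srw_prob] splits off the first step; the induction for reversibility also
    needs to split off the last. *)
Lemma srw_prob_last n x y :
  p n.+1 x y = \sum_(z <- nbrs y) p n x z / d z.
Proof.
have unb z : uniq (nbrs z) by case: Hgraph => _ _; apply.
elim: n x => [|n IH] x.
  rewrite /= sum_delta// adjC.
  under eq_bigr do rewrite eq_sym -[_%:R]mulr1.
  by rewrite sum_delta// mulr1 mulrC adjC.
transitivity ((d x)^-1 * \sum_(z <- nbrs x) p n.+1 z y); first by [].
under eq_bigr do rewrite IH.
rewrite exchange_big big_distrr/=; apply: eq_bigr => z _.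
by rewrite -big_distrl/= mulrA.
Qed.

Lemma srw_prob_rev n x y : d x * p n x y = d y * p n y x.
Proof.
elim: n x y => [|n IH] x y.
  by have [->|xy] := eqVneq x y; rewrite //= (negPf xy) eq_sym (negPf xy) !mulr0.
rewrite srw_prob_last /= mulrA divff// mul1r big_distrr/=; apply: eq_bigr => z _.
by rewrite mulrA IH mulrAC divff ?mul1r.
Qed.

Lemma srw_prob_chain k n x y z : p k x y * p n y z <= p (k + n) x z.
Proof.
elim: k x => [|k IH] x.
  by rewrite /= add0n; have [->|_] := eqVneq x y; rewrite ?mul1r// mul0r srw_prob_ge0.
rewrite addSn /= -mulrA ler_wpM2l ?invr_ge0// big_distrl/= ler_sum//.
Qed.

Lemma srw_prob_path x s : path (adj nbrs) x s -> 0 < p (size s) x (last x s).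
Proof.
elim: s x => [|z s IH] x /=; first by rewrite eqxx.
move=> /andP[xz /IH ps]; rewrite mulr_gt0 ?invr_gt0//.
rewrite (big_rem z)//= ltr_pwDl// sumr_ge0// => w _; exact: srw_prob_ge0.
Qed.

Definition green_sum N x y : R := \sum_(n < N) p n x y.

Lemma green_sumE N x y :
  (\sum_(0 <= n < N) (p n x y)%:E)%E = (green_sum N x y)%:E.
Proof. by rewrite big_mkord sumEFin. Qed.

Lemma green_sum_le N x y : ((green_sum N x y)%:E <= visits nbrs R x y)%E.
Proof.
rewrite -green_sumE; apply: nneseries_lim_ge => n _ _.
by rewrite lee_fin srw_prob_ge0.
Qed.

Lemma visits_le x y B : (forall N, green_sum N x y <= B) ->
  (visits nbrs R x y <= B%:E)%E.
Proof.
move=> gB; apply: lime_le.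
  by apply: is_cvg_nneseries => n _ _; rewrite lee_fin srw_prob_ge0.
by apply: nearW => N; rewrite green_sumE lee_fin.
Qed.

Hypothesis Hconn : connected_graph nbrs.
Hypothesis Htrans : transient nbrs R.

(** Transience bounds the diagonal only. A path from [y] to [x] is followed with positive
    probability, and then every visit to [y] from [x] counts as a visit to [y] from [y]. *)
Lemma visits_lty x y : (visits nbrs R x y < +oo)%E.
Proof.
have [s [ps sx]] := Hconn y x.
have pk := srw_prob_path ps; rewrite sx in pk.
have := Htrans y; rewrite ltey => /eqP yy.
have yfin : visits nbrs R y y \is a fin_num.
  by rewrite ge0_fin_numE ?Htrans// (le_trans _ (green_sum_le 0 y y))// lee_fin /green_sum big_ord0.
apply: (@le_lt_trans _ _ (fine (visits nbrs R y y) / p (size s) y x)%:E); last exact: ltry.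
apply: visits_le => N; rewrite ler_pdivlMr//.
rewrite -lee_fin fineK//; apply: le_trans (green_sum_le (size s + N) y y).
rewrite lee_fin /green_sum big_split_ord/= -[leLHS]add0r lerD//.
  by apply: sumr_ge0 => n _; exact: srw_prob_ge0.
rewrite mulrC big_distrr/= ler_sum// => n _; exact: srw_prob_chain.
Qed.

Notation W x y := (fine (visits nbrs R x y)).

Lemma visits_fin x y : visits nbrs R x y \is a fin_num.
Proof.
rewrite ge0_fin_numE ?visits_lty// (le_trans _ (green_sum_le 0 x y))//.
by rewrite lee_fin /green_sum big_ord0.
Qed.

Lemma cvg_green_sum x y : green_sum N x y @[N --> \oo] --> W x y.
Proof.
suff : (green_sum N x y)%:E @[N --> \oo] --> (W x y)%:E by move/fine_cvg.
rewrite fineK ?visits_fin//; under eq_fun do rewrite -green_sumE.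
by apply: is_cvg_nneseries => n _ _; rewrite lee_fin srw_prob_ge0.
Qed.

Lemma visits_rev x y : d x * W x y = d y * W y x.
Proof.
have h1 : d x * green_sum N x y @[N --> \oo] --> d x * W x y.
  by apply: cvgM; [exact: cvg_cst|exact: cvg_green_sum].
have h2 : d y * green_sum N y x @[N --> \oo] --> d y * W y x.
  by apply: cvgM; [exact: cvg_cst|exact: cvg_green_sum].
have h : (fun N => d x * green_sum N x y) = (fun N => d y * green_sum N y x).
  apply/funext => N; rewrite !big_distrr/=; apply: eq_bigr => n _.
  exact: srw_prob_rev.
rewrite h in h1; exact: cvg_unique h1 h2.
Qed.

Lemma green_sym x y : green nbrs R x y = green nbrs R y x.
Proof.
rewrite /green; apply: (mulfI (d_neq0 x)); rewrite mulrA visits_rev.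
by rewrite mulrAC divff// mul1r mulrCA divff// mulr1.
Qed.

(** * Last exit decomposition and equilibrium potential *)

Section avoid.
Variable K : {fset V}.
Notation a := (avoid_prob nbrs R K).

Lemma avoid_prob_ge0 n x : 0 <= a n x.
Proof.
elim: n x => [|n IH] x //=.
by rewrite mulr_ge0 ?invr_ge0// sumr_ge0// => z _; case: ifP.
Qed.

Lemma avoid_prob_dec n x : a n.+1 x <= a n x.
Proof.
elim: n x => [|n IH] x.
  rewrite [leRHS]/= /= mulrC ler_pdivrMr// mul1r.
  rewrite (@le_trans _ _ (\sum_(z <- nbrs x) 1))//.
    by apply: ler_sum => z _; case: ifP.
  by rewrite big_const_seq count_predT iter_addr_0.
rewrite [leRHS]/= [leLHS]/= ler_wpM2l ?invr_ge0// ler_sum// => z _.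
by case: ifP => // _; exact: IH.
Qed.

Lemma avoid_prob_le1 n x : a n x <= 1.
Proof.
by elim: n => [|n IH]//; rewrite (le_trans (avoid_prob_dec _ _)).
Qed.

Lemma cvg_avoid_prob x : a n x @[n --> \oo] --> escape_prob nbrs R K x.
Proof.
apply: nonincreasing_is_cvgn.
  by apply/nonincreasing_seqP => n; exact: avoid_prob_dec.
by exists 0 => _ [n _ <-]; exact: avoid_prob_ge0.
Qed.

Lemma escape_prob_ge0 x : 0 <= escape_prob nbrs R K x.
Proof.
apply: limr_ge; first by apply/cvg_ex; eexists; exact: cvg_avoid_prob.
by apply: nearW => n; exact: avoid_prob_ge0.
Qed.

Lemma escape_prob_le n x : escape_prob nbrs R K x <= a n x.
Proof.
apply: (nonincreasing_cvgn_ge (u_ := a ^~ x)).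
  by apply/nonincreasing_seqP => m; exact: avoid_prob_dec.
by apply/cvg_ex; eexists; exact: cvg_avoid_prob.
Qed.

Lemma escape_prob_interior x : {subset nbrs x <= K} -> escape_prob nbrs R K x = 0.
Proof.
move=> xK; apply/eqP; rewrite eq_le escape_prob_ge0 andbT.
rewrite (le_trans (escape_prob_le 1 x))//= big_seq big1 ?mulr0// => z zx.
by rewrite xK.
Qed.

(* Both sides are the probability of a visit to [K] up to time [N]; the left one is
   decomposed along the last visit. *)
Lemma last_exit N x :
  \sum_(n < N.+1) \sum_(y <- K) p n x y * a (N - n) y =
  1 - (if x \in K then 0 else a N x).
Proof.
elim: N x => [|N IH] x.
  rewrite big_ord1 /=; under eq_bigr do rewrite /=.
  by rewrite sum_delta//= mulr1; case: ifP; rewrite ?subr0 ?subrr.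
rewrite big_ord_recl subn0 /= sum_delta//.
have -> : \sum_(i < N.+1) \sum_(y <- K) p (bump 0 i) x y * a (N.+1 - bump 0 i) y =
    1 - a N.+1 x.
  transitivity ((d x)^-1 * \sum_(z <- nbrs x) (1 - (if z \in K then 0 else a N z))).
    under [in RHS]eq_bigr do rewrite -IH.
    rewrite [in RHS]exchange_big big_distrr/=; apply: eq_bigr => i _.
    rewrite [in RHS]exchange_big big_distrr/=; apply: eq_bigr => y _.
    by rewrite /bump/= subSS -mulrA big_distrl.
  rewrite sumrB mulrBr big_const_seq count_predT iter_addr_0 mulVf//.
rewrite /=; case: ifP => _; rewrite ?mul1r ?mul0r; ring.
Qed.

Definition eqm x : R := d x * escape_prob nbrs R K x.

Lemma eqm_ge0 x : 0 <= eqm x.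
Proof. by rewrite mulr_ge0// escape_prob_ge0. Qed.

Lemma green_eqm x y : green nbrs R x y * eqm y = W x y * escape_prob nbrs R K y.
Proof. by rewrite /green /eqm mulrA divfK. Qed.

Lemma potential_le1 x : \sum_(y <- K) green nbrs R x y * eqm y <= 1.
Proof.
under eq_bigr do rewrite green_eqm.
have h : \sum_(y <- K) green_sum N.+1 x y * escape_prob nbrs R K y @[N --> \oo]
    --> \sum_(y <- K) W x y * escape_prob nbrs R K y.
  apply: cvg_sumr => y; apply: cvgM; last exact: cvg_cst.
  have := @cvg_green_sum x y; rewrite -cvg_shiftS; exact.
rewrite -(cvg_lim _ h)//; apply: limr_le; first by apply/cvg_ex; eexists; exact: h.
apply: nearW => N.
have -> : \sum_(y <- K) green_sum N.+1 x y * escape_prob nbrs R K y =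
    \sum_(n < N.+1) \sum_(y <- K) p n x y * escape_prob nbrs R K y.
  by rewrite exchange_big; apply: eq_bigr => y _; rewrite big_distrl.
apply: (@le_trans _ _ (\sum_(n < N.+1) \sum_(y <- K) p n x y * a (N - n) y)).
  apply: ler_sum => n _; apply: ler_sum => y _.
  by rewrite ler_wpM2l ?srw_prob_ge0// escape_prob_le.
rewrite last_exit gerBl; case: ifP => // _; exact: avoid_prob_ge0.
Qed.

(** In [last_exit] the factor [a (N - n)] is far from its limit when [n] is close to [N]. Over the
    horizon [N + m], the times up to [N] get the bound [a m] and the last [m] times the trivial
    bound 1; the latter contribute a tail of the Green sum, which vanishes as [N] grows, before [m]
    does. *)
Lemma potential_eq1 x : x \in K -> \sum_(y <- K) green nbrs R x y * eqm y = 1.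
Proof.
move=> xK; apply/eqP; rewrite eq_le potential_le1/=.
under eq_bigr do rewrite green_eqm.
have h : \sum_(y <- K) W x y * a m y @[m --> \oo]
    --> \sum_(y <- K) W x y * escape_prob nbrs R K y.
  apply: cvg_sumr => y; apply: cvgM; first exact: cvg_cst.
  exact: cvg_avoid_prob.
rewrite -(cvg_lim _ h)//; apply: limr_ge; first by apply/cvg_ex; eexists; exact: h.
apply: nearW => m.
have hm : \sum_(y <- K) (green_sum N.+1 x y * a m y +
      (green_sum (N.+1 + m) x y - green_sum N.+1 x y)) @[N --> \oo]
    --> \sum_(y <- K) W x y * a m y.
  have -> : \sum_(y <- K) W x y * a m y = \sum_(y <- K) (W x y * a m y + (W x y - W x y)).
    by apply: eq_bigr => y _; rewrite subrr addr0.
  have cG y : green_sum N.+1 x y @[N --> \oo] --> W x y.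
    have := @cvg_green_sum x y; rewrite -cvg_shiftS; exact.
  apply: cvg_sumr => y; apply: cvgD.
    apply: cvgM; [exact: cG|exact: cvg_cst].
  apply: cvgB; last exact: cG.
  have := @cvg_green_sum x y; rewrite -(cvg_shiftn m.+1).
  by under eq_fun do rewrite addnS -addSn.
rewrite -(cvg_lim _ hm)//; apply: limr_ge; first by apply/cvg_ex; eexists; exact: hm.
apply: nearW => N.
have := last_exit (N + m) x; rewrite xK subr0 => <-.
rewrite exchange_big/=; apply: ler_sum => y _.
rewrite /green_sum -addSn !big_split_ord addrAC subrr add0r lerD//.
  rewrite big_distrl/= ler_sum// => n _; rewrite ler_wpM2l ?srw_prob_ge0//.
  have /nonincreasing_seqP : forall k, a k.+1 y <= a k y.
    by move=> k; exact: avoid_prob_dec.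
  by apply; rewrite addnC -addnBA ?leq_addr// -ltnS.
apply: ler_sum => n _; rewrite ler_piMr ?srw_prob_ge0//; exact: avoid_prob_le1.
Qed.

Lemma capacityE : capacity nbrs R K = \sum_(x <- K) eqm x.
Proof. by []. Qed.

Lemma capacity_ge0 : 0 <= capacity nbrs R K.
Proof. by apply: sumr_ge0 => x _; exact: eqm_ge0. Qed.

Lemma capacity_gt0 x : x \in K -> 0 < capacity nbrs R K.
Proof.
move=> xK; rewrite lt_def capacity_ge0 andbT; apply/eqP => /eqP.
rewrite capacityE big_seq psumr_eq0 => [/allP e0|y _]; last exact: eqm_ge0.
have := potential_eq1 xK; rewrite big_seq big1 => [/eqP|y yK].
  by rewrite eq_sym oner_eq0.
by have := e0 _ yK; rewrite yK => /eqP ->; rewrite mulr0.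
Qed.

End avoid.

(** The potential of the equilibrium measure of [K'] is 1 on [K]. By symmetry of the Green function,
    the capacity of [K] is thus the integral of the potential of [K], at most 1, against the
    equilibrium measure of [K']. *)
Lemma capacity_le (K K' : {fset V}) : (K `<=` K')%fset ->
  capacity nbrs R K <= capacity nbrs R K'.
Proof.
move=> /fsubsetP KK'; rewrite !capacityE.
have -> : \sum_(x <- K) eqm K x =
    \sum_(y <- K') eqm K' y * \sum_(x <- K) green nbrs R y x * eqm K x.
  transitivity (\sum_(x <- K) eqm K x * \sum_(y <- K') green nbrs R x y * eqm K' y).
    by rewrite [LHS]big_seq [RHS]big_seq; apply: eq_bigr => x /KK' xK;
      rewrite potential_eq1// mulr1.
  under eq_bigr do rewrite big_distrr/=.
  rewrite exchange_big/=; apply: eq_bigr => y _; rewrite big_distrr/=.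
  by apply: eq_bigr => x _; rewrite green_sym; ring.
by apply: ler_sum => y _; rewrite ler_piMr ?eqm_ge0// potential_le1.
Qed.

End potential_theory.

(** * The Cameron-Martin formula *)

Section level_event.
Context {R : realType} {I : eqType}.
Variables (s : seq I) (A : pred I).

Definition level_event (h : R) (y : I -> R) : bool :=
  all (fun x => if A x then h <= y x else y x < h) s.

Lemma lin_coord x (y : I -> R) : x \in s -> uniq s ->
  lin_form s (fun z => (z == x)%:R) y = y x.
Proof.
move=> xs us; rewrite /lin_form (bigD1_seq x)//= eqxx mul1r big1 ?addr0// => z /negPf ->.
by rewrite mul0r.
Qed.

Lemma tc_level_event h : uniq s -> trig_closure s (fun y => (level_event h y)%:R).
Proof.
move=> us.
have -> : (fun y : I -> R => (level_event h y)%:R) = (fun y => \prod_(x <- s)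
    (if A x then (h <= lin_form s (fun z => (z == x)%:R) y)%R%:R
     else (lin_form s (fun z => (z == x)%:R) y < h)%R%:R)) :> (_ -> R).
  apply/funext => y; rewrite /level_event -big_all.
  rewrite (big_morph (fun b : bool => b%:R : R) (id1 := 1) (op1 := *%R))//; last first.
    by case=> [] [] /=; ring.
  rewrite big_seq [RHS]big_seq; apply: eq_bigr => x xs.
  by rewrite lin_coord//; case: (A x).
apply: tc_prod => x; case: (A x); [exact: tc_ge|exact: tc_lt].
Qed.

Lemma level_event_shift h t (y : I -> R) :
  level_event h (fun x => y x - t) = level_event (h + t) y.
Proof. by apply: eq_all => x; rewrite lerBrDr ltrBlDr. Qed.

End level_event.

Section cameron_martin.
Context {R : realType} {V : choiceType} (K : {fset V}).
Context d (T : measurableType d) (P : probability T R).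
Variable phi : V -> T -> R.
Hypothesis mphi : forall x, measurable_fun setT (phi x).
Variable g : V -> V -> R.
Let q (a : V -> R) := \sum_(x <- K) \sum_(y <- K) a x * a y * g x y.
Hypothesis phi_cos : forall a,
  (\int[P]_w (cos (lin_form K a (phi ^~ w)))%:E = (expR (- q a / 2))%:E)%E.
Hypothesis phi_sin : forall a,
  (\int[P]_w (sin (lin_form K a (phi ^~ w)))%:E = 0%E)%E.

(** The degenerate counterpart of [cameron_martin]: the field on [K] has the law of the zero field,
    for which all levels [l <= 0] give the same event. *)
Lemma level_event_null (A : pred V) (h h' : R) :
  (forall x y, x \in K -> y \in K -> g x y = 0) -> h <= 0 -> h' <= 0 ->
  (\int[P]_w ((level_event K A h (phi ^~ w))%:R)%:E =
   \int[P]_w ((level_event K A h' (phi ^~ w))%:R)%:E)%E.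
Proof.
move=> g0 h0 h'0; pose z (x : V) (w : T) : R := 0.
have lin0 a w : lin_form K a (z ^~ w) = 0.
  by rewrite /lin_form big1// => x _; rewrite mulr0.
have q0 a : q a = 0.
  rewrite /q big_seq big1// => x xK; rewrite big_seq big1// => y yK.
  by rewrite g0// mulr0.
have ec a : (\int[P]_w (cos (lin_form K a (phi ^~ w)))%:E = \int[P]_w (cos (lin_form K a (z ^~ w)))%:E)%E.
  rewrite phi_cos q0 oppr0 mul0r expR0; under eq_integral do rewrite lin0 cos0.
  by rewrite (eq_integral (cst 1%E))// integral_cst// mul1e; exact/esym/probability_setT.
have es a : (\int[P]_w (sin (lin_form K a (phi ^~ w)))%:E = \int[P]_w (sin (lin_form K a (z ^~ w)))%:E)%E.
  rewrite phi_sin; under eq_integral do rewrite lin0 sin0.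
  by rewrite integral0.
have mz x : measurable_fun setT (z x) by exact: measurable_cst.
have E (l : R) : l <= 0 -> (\int[P]_w ((level_event K A l (phi ^~ w))%:R)%:E =
    \int[P]_w ((level_event K A 0 (z ^~ w))%:R)%:E)%E.
  move=> l0; rewrite (integral_trig_closure mphi mz ec es (tc_level_event A l (fset_uniq K))).
  apply: eq_integral => w _; congr (_%:R)%:E; congr nat_of_bool; apply: eq_all => x.
  by case: (A x); rewrite ?lexx ?ltxx// ltNge l0.
by rewrite !E.
Qed.

Variable e : V -> R.
Hypothesis gsym : forall x y, g x y = g y x.
Hypothesis ge1 : forall x, x \in K -> \sum_(y <- K) g x y * e y = 1.
Let c := \sum_(x <- K) e x.
Hypothesis c0 : 0 < c.
Let s : R := (Num.sqrt c)^-1.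

Let s2 : s ^+ 2 = c^-1.
Proof. by rewrite exprVn sqr_sqrtr// ltW. Qed.

Let s0 : s != 0.
Proof. by rewrite invr_eq0 gt_eqF// sqrtr_gt0. Qed.

Let N : probability (measurableTypeR R) R := normal_prob 0 s.
Let PN : probability (T * measurableTypeR R)%type R := (P \x N)%E.

Let M w := lin_form K e (phi ^~ w).

(* The part of the field independent of [M], plus an independent copy of [M / c]. *)
Let Y x (z : T * measurableTypeR R) : R := phi x z.1 - M z.1 / c + z.2.

Let mM : measurable_fun setT M.
Proof. exact: measurable_lin_form. Qed.

Let mY x : measurable_fun setT (Y x).
Proof.
apply: measurable_funD; last exact: measurable_snd.
apply: measurable_funB; first by apply: measurableT_comp => //; exact: measurable_fst.
apply: measurable_funM => //.
by apply: measurableT_comp => //; exact: measurable_fst.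
Qed.

Let tot (a : V -> R) := \sum_(x <- K) a x.
(** By [ge1], the covariance of [lin_form K a] with [M] is [tot a] and the variance of [M] is [c].
    So [ort a] gives the component uncorrelated with [M], and [q_ort] is Pythagoras. *)
Let ort (a : V -> R) := fun x => a x - tot a / c * e x.

Let linY a z : lin_form K a (Y ^~ z) = tot a * z.2 + lin_form K (ort a) (phi ^~ z.1).
Proof.
rewrite /ort lin_formB lin_formZ -/(M z.1) /lin_form /Y /tot.
under eq_bigr do rewrite mulrDr mulrBr.
by rewrite big_split/= sumrB -!big_distrl/=; ring.
Qed.

Let q_ort a : q (ort a) + tot a ^+ 2 / c = q a.
Proof.
have B1 (b : V -> R) : \sum_(x <- K) \sum_(y <- K) b x * e y * g x y = tot b.
  rewrite /tot !big_seq; apply: eq_bigr => x xK.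
  rewrite -[RHS]mulr1 -(ge1 xK) big_distrr/=; apply: eq_bigr => y _; ring.
have B2 (b : V -> R) : \sum_(x <- K) \sum_(y <- K) e x * b y * g x y = tot b.
  rewrite exchange_big/= -[RHS]B1; apply: eq_bigr => x _; apply: eq_bigr => y _.
  by rewrite gsym; ring.
set k := tot a / c.
have -> : q (ort a) = q a - k * \sum_(x <- K) \sum_(y <- K) a x * e y * g x y
    - k * \sum_(x <- K) \sum_(y <- K) e x * a y * g x y
    + k ^+ 2 * \sum_(x <- K) \sum_(y <- K) e x * e y * g x y.
  rewrite /q !big_distrr/= -!sumrB -big_split/=; apply: eq_bigr => x _.
  rewrite !big_distrr/= -!sumrB -big_split/=; apply: eq_bigr => y _.
  rewrite /ort -/k; ring.
rewrite !B1 B2 (_ : tot e = c)// /k; field.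
by rewrite gt_eqF.
Qed.

(** The phase covers both characteristic identities: [th = 0] gives the cosine and [th = - pi / 2]
    the sine. *)
Let Y_cos_phase a th :
  (\int[PN]_z (cos (lin_form K a (Y ^~ z) + th))%:E =
   (expR (- (tot a ^+ 2 / c / 2)))%:E *
     \int[P]_w (cos (lin_form K (ort a) (phi ^~ w) + th))%:E)%E.
Proof.
have mcos : measurable_fun setT (fun z => cos (lin_form K a (Y ^~ z) + th)).
  apply: measurableT_comp; last by apply: measurable_funD => //; exact: measurable_lin_form.
  by apply: continuous_measurable_fun; exact: continuous_cos.
have mcosP : measurable_fun setT (fun w => cos (lin_form K (ort a) (phi ^~ w) + th)).
  apply: measurableT_comp; last by apply: measurable_funD => //; exact: measurable_lin_form.
  by apply: continuous_measurable_fun; exact: continuous_cos.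
have cos1 x : `|cos x| <= 1 :> R by rewrite ler_norml cos_geN1 cos_le1.
rewrite -(@integral12_prod_meas1 _ _ _ _ R P N (fun z => (cos (lin_form K a (Y ^~ z) + th))%:E)); last first.
  apply: (@measurable_bounded_integrable _ _ _ PN (fun z => cos (lin_form K a (Y ^~ z) + th)) setT) => //.
  - by rewrite (le_lt_trans (probability_le1 _ _)) ?ltry.
  - exists 1; split; first exact: num_real.
    by move=> x x1 y _ /=; rewrite (le_trans (cos1 _))// ltW.
rewrite -integralZl//=; last first.
  apply: (@measurable_bounded_integrable _ _ _ P (fun w => cos (lin_form K (ort a) (phi ^~ w) + th)) setT) => //.
  - by rewrite (le_lt_trans (probability_le1 _ _)) ?ltry.
  - exists 1; split; first exact: num_real.
    by move=> x x1 y _ /=; rewrite (le_trans (cos1 _))// ltW.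
apply: eq_integral => w _.
transitivity (\int[N]_u (cos (tot a * u + (lin_form K (ort a) (phi ^~ w) + th)))%:E)%E.
  by apply: eq_integral => u _; rewrite linY/= addrA.
by rewrite integral_normal_cos// s2 EFinM [c^-1 * _]mulrC.
Qed.

Let eq_cos a : (\int[P]_w (cos (lin_form K a (phi ^~ w)))%:E =
  \int[PN]_z (cos (lin_form K a (Y ^~ z)))%:E)%E.
Proof.
have := Y_cos_phase a 0; under eq_integral do rewrite addr0; move=> ->.
under [in RHS]eq_integral do rewrite addr0.
rewrite !phi_cos -EFinM -expRD -(q_ort a); congr (expR _)%:E.
by field; rewrite gt_eqF.
Qed.

Let eq_sin a : (\int[P]_w (sin (lin_form K a (phi ^~ w)))%:E =
  \int[PN]_z (sin (lin_form K a (Y ^~ z)))%:E)%E.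
Proof.
have cs (x : R) : cos (x + - (pi / 2)) = sin x.
  by rewrite cosB cos_pihalf sin_pihalf mulr0 add0r mulr1.
have := Y_cos_phase a (- (pi / 2)); under eq_integral do rewrite cs; move=> ->.
under [in RHS]eq_integral do rewrite cs.
by rewrite !phi_sin mule0.
Qed.

Let linYe z : lin_form K e (Y ^~ z) = c * z.2.
Proof.
rewrite linY -/c /ort (_ : lin_form K _ _ = 0) ?addr0//.
by rewrite /lin_form big1// => x _; rewrite /tot -/c divff ?gt_eqF// mul1r subrr mul0r.
Qed.

Lemma cameron_martin (A : pred V) (h t : R) :
  (\int[P]_w ((level_event K A h (phi ^~ w))%:R *
      expR (- (t * lin_form K e (phi ^~ w)) - t ^+ 2 * c / 2))%:E =
   \int[P]_w ((level_event K A (h + t) (phi ^~ w))%:R)%:E)%E.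
Proof.
pose f (m : R) := expR (- (t * m) - t ^+ 2 * c / 2).
have mf : measurable_fun setT f.
  apply: measurableT_comp => //; apply: measurable_funB => //.
  by apply: measurableT_comp => //; exact: measurable_funM.
have f0 m : 0 <= f m by exact: expR_ge0.
have tE (l : R) := tc_level_event A l (fset_uniq K).
have mev l : measurable_fun setT (fun z => (level_event K A l (Y ^~ z))%:R : R).
  exact: (measurable_trig_closure mY (tE l)).
rewrite (integral_event_lin_form mphi mY eq_cos eq_sin e (tE h) mf f0).
rewrite (integral_trig_closure mphi mY eq_cos eq_sin (tE (h + t))).
rewrite (@fubini_tonelli1 _ _ _ _ R P N); last 2 first.
- apply/measurable_EFinP; apply: measurable_funM; first exact: mev.
  by apply: measurableT_comp => //; exact: measurable_lin_form.
- by move=> z; rewrite lee_fin mulr_ge0.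
rewrite (@fubini_tonelli1 _ _ _ _ R P N (fun z => ((level_event K A (h + t) (Y ^~ z))%:R)%:E)); last 2 first.
- by apply/measurable_EFinP; exact: mev.
- by move=> z; rewrite lee_fin.
apply: eq_integral => w _; rewrite /fubini_F.
pose G (u : R) : R := (level_event K A h (Y ^~ (w, u)))%:R.
have mG : measurable_fun setT G.
  exact: (measurable_fun_pair2 w (mev h)).
(* For fixed [w] the integral of [Y] against [e] is [c * u], and [u] has variance [1 / c]; so the
   weight is that of a shift of [u] by [t], which moves all coordinates of [Y] together. *)
have := normal_prob_shift s0 t mG (fun u => ler0n _ _).
rewrite -/N => NE; transitivity (\int[N]_u (G (u - t))%:E)%E.
  rewrite -NE; apply: eq_integral => u _; rewrite linYe mulrC /f; congr (expR _ * _)%:E.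
  by rewrite s2 /=; field; rewrite gt_eqF.
apply: eq_integral => u _; rewrite /G -level_event_shift; congr (_%:R)%:E; congr nat_of_bool.
by apply: eq_all => x; rewrite /Y/= addrA.
Qed.

End cameron_martin.

(** * Cluster observables *)

Section clusters.
Variables (V : choiceType) (nbrs : V -> seq V) (R : realType).
Variables (d : measure_display) (T : measurableType d).
Variables (phi : V -> T -> R) (X : {fset V}).
Notation adj := (Defs.adj nbrs).
Notation cluster h w := (Defs.cluster nbrs phi h X w).
Implicit Types (S : {fset V}) (h : R) (w : T).

(** Vertices of [X] outside [S] must also be seen to lie below the level; with them and the outer
    boundary, the field on the hull decides whether [S] is the cluster. *)
Definition hull S : {fset V} := (Defs.fclosure nbrs S `|` X)%fset.

(** The deterministic part of the event: given [S], [is_cluster] is either empty or a level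
    event. *)
Definition linked S : bool := `[< forall y, y \in S -> exists2 x, x \in X &
  exists s, [/\ path adj x s, last x s = y & all (fun z => z \in S) (x :: s)] >].

Definition is_cluster h S w : bool :=
  linked S && level_event (hull S) (fun x => x \in S) h (phi ^~ w).

Lemma in_fclosure S y : reflect (y \in S \/ exists2 x, x \in S & adj x y)
  (y \in Defs.fclosure nbrs S).
Proof.
rewrite /Defs.fclosure in_fsetU inE /=; apply: (iffP orP) => -[yS|yS]; try by left.
- by right; have /flatten_mapP[x xS xy] := yS; exists x.
- by right; apply/flatten_mapP; case: yS => x xS xy; exists x.
Qed.

Lemma sub_fclosure S : (S `<=` Defs.fclosure nbrs S)%fset.
Proof. by apply/fsubsetP => x xS; apply/in_fclosure; left. Qed.

Lemma sub_hull S : (S `<=` hull S)%fset.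
Proof. by rewrite fsubsetU// sub_fclosure. Qed.

(** A path above the level that starts in [X] starts in [S] and cannot leave it, since the rest of
    the hull lies below the level; [linked] gives the other inclusion. *)
Lemma is_clusterP h S w : reflect (cluster h w = [set` S]) (is_cluster h S w).
Proof.
apply: (iffP andP) => [[/asboolP lS /allP lev]|CS].
  apply/seteqP; split => y /=.
    case=> x xX [s [ps <- /= /andP[hx hs]]].
    have xS : x \in S.
      have /lev : x \in hull S by rewrite in_fsetU xX orbT.
      by case: ifP => // _; rewrite ltNge hx.
    elim: s x xS ps hs {xX hx} => //= z s IH x xS /andP[xz ps] /andP[hz hs].
    apply: IH => //; have /lev : z \in hull S.
      by rewrite in_fsetU; apply/orP; left; apply/in_fclosure; right; exists x.
    by case: ifP => // _; rewrite ltNge hz.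
  move=> yS; have [x xX [s [ps sy sS]]] := lS y yS; exists x => //; exists s; split => //.
  apply/allP => z /(allP sS) zS.
  by have := lev z (fsubsetP (sub_hull S) _ zS); rewrite zS.
have inS y : cluster h w y -> y \in S by rewrite CS.
have Sin y : y \in S -> cluster h w y by rewrite CS.
split.
  apply/asboolP => y /Sin[x xX [s [ps sy hs]]]; exists x => //; exists s; split => //.
  apply/allP => z zs; apply: inS; exists x => //.
  move: zs ps hs {sy}; case/splitPl => p1 p2 p1z; rewrite cat_path => /andP[pp1 _].
  by rewrite -cat_cons all_cat => /andP[h1 _]; exists p1.
apply/allP => z zK; case: ifPn => [zS|zS].
  have [x xX [s [_ sz /allP hs]]] := Sin z zS; apply: hs.
  by rewrite -sz mem_last.
rewrite ltNge; apply: contra zS => hz.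
move: zK; rewrite in_fsetU => /orP[/in_fclosure[//|[y /Sin[x xX [s [ps sy hs]]] yz]]|zX].
  apply: inS; exists x => //; exists (rcons s z); split.
  - by rewrite rcons_path ps sy.
  - by rewrite last_rcons.
  - by rewrite -rcons_cons all_rcons hz.
by apply: inS; exists z => //; exists [::]; split => //=; rewrite hz.
Qed.

Lemma is_cluster_inj h w S S' : is_cluster h S w -> is_cluster h S' w -> S = S'.
Proof.
move=> /is_clusterP e /is_clusterP; rewrite e => SS'.
have SS'E x : [set` S] x = [set` S'] x by rewrite SS'.
by apply/fsetP => x; apply/idP/idP; have /= := SS'E x => ->.
Qed.

Lemma is_cluster_fset_set h w : finite_set (cluster h w) ->
  is_cluster h (fset_set (cluster h w)) w.
Proof. by move=> fC; apply/is_clusterP; rewrite fset_setK. Qed.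

(** [G] may depend on the sample, because densities and their expansion coefficients are integrated
    over the cluster events too. *)
Definition cluster_obs (G : {fset V} -> T -> R) h w : R :=
  if `[< finite_set (cluster h w) >] then G (fset_set (cluster h w)) w else 0.

Lemma cluster_obsE G h S w : is_cluster h S w -> cluster_obs G h w = G S w.
Proof.
by move=> /is_clusterP CS; rewrite /cluster_obs CS asboolT ?set_fsetK//; exact: finite_fset.
Qed.

Lemma cluster_obs_spec G h w : (exists2 S, is_cluster h S w & cluster_obs G h w = G S w) \/
  (forall S, ~~ is_cluster h S w) /\ cluster_obs G h w = 0.
Proof.
have [fC|fC] := pselect (finite_set (cluster h w)).
  left; exists (fset_set (cluster h w)); first exact: is_cluster_fset_set.
  exact/cluster_obsE/is_cluster_fset_set.
right; split; last by rewrite /cluster_obs asboolF.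
by move=> S; apply/negP => /is_clusterP CS; apply: fC; rewrite CS; exact: finite_fset.
Qed.

Lemma cluster_obs_comp (u : R -> R) G h w : u 0 = 0 ->
  u (cluster_obs G h w) = cluster_obs (fun S w => u (G S w)) h w.
Proof. by move=> u0; rewrite /cluster_obs; case: ifP. Qed.

Lemma cluster_obs_ge0 G h w : (forall S, is_cluster h S w -> 0 <= G S w) -> 0 <= cluster_obs G h w.
Proof. by move=> G0; have [[S /G0 GS ->//]|[_ ->]] := cluster_obs_spec G h w. Qed.

Lemma cluster_obs_le G G' h w : (forall S, is_cluster h S w -> G S w <= G' S w) ->
  cluster_obs G h w <= cluster_obs G' h w.
Proof.
by move=> GG'; have [[S hS ->]|[hS ->]] := cluster_obs_spec G h w;
  [rewrite (cluster_obsE _ hS) GG'|rewrite cluster_obs_ge0// => S; rewrite (negPf (hS S))].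
Qed.

Lemma norm_cluster_obs G h w : `|cluster_obs G h w| = cluster_obs (fun S w => `|G S w|) h w.
Proof. by rewrite /cluster_obs; case: ifP => //; rewrite normr0. Qed.

(** [V] is only a choice type: balls around [X] give an increasing sequence of finite families of
    candidate clusters, as measurability and monotone convergence require. *)
Definition nbhd N : {fset V} := iter N (Defs.fclosure nbrs) X.

Lemma nbhd_mono m n : (m <= n)%N -> (nbhd m `<=` nbhd n)%fset.
Proof.
move=> /subnK <-; elim: (n - m)%N => // k IH.
by rewrite addSn /= (fsubset_trans IH)// sub_fclosure.
Qed.

Lemma nbhd_path k x s : x \in nbhd k -> path adj x s -> last x s \in nbhd (k + size s).
Proof.
elim: s k x => [|z s IH] k x; first by rewrite addn0.
move=> xk /= /andP[xz ps]; rewrite addnS -addSn; apply: IH => //=.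
by apply/in_fclosure; right; exists x.
Qed.

Lemma cluster_in_nbhd h w y : cluster h w y -> exists N, y \in nbhd N.
Proof.
by move=> [x xX [s [ps <- _]]]; exists (0 + size s)%N; apply: nbhd_path.
Qed.

Lemma is_cluster_nbhd h S w : is_cluster h S w -> exists N, (S `<=` nbhd N)%fset.
Proof.
move=> /is_clusterP CS.
suff /(_ S) [] : forall s : seq V, {subset s <= S} -> exists N, {subset s <= nbhd N}.
- by [].
- by move=> N SN; exists N; apply/fsubsetP.
elim=> [|y s IH] sS; first by exists 0%N.
have [x xs|N1 h1] := IH; first by apply: sS; rewrite inE xs orbT.
have /cluster_in_nbhd[N2 h2] : cluster h w y by rewrite CS /=; apply: sS; rewrite mem_head.
exists (maxn N1 N2) => x; rewrite inE => /predU1P[->|/h1 xN].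
  exact: (fsubsetP (nbhd_mono (leq_maxr _ _))).
exact: (fsubsetP (nbhd_mono (leq_maxl _ _))).
Qed.

Definition cluster_obs_in N (G : {fset V} -> T -> R) h w : R :=
  \sum_(S <- fpowerset (nbhd N)) (is_cluster h S w)%:R * G S w.

Lemma cluster_obs_inE N G h S w : is_cluster h S w ->
  cluster_obs_in N G h w = (S \in fpowerset (nbhd N))%:R * G S w.
Proof.
move=> hS; rewrite /cluster_obs_in; have [SN|SN] := boolP (S \in _).
  rewrite (bigD1_seq S SN (fset_uniq _)) /= hS big1 ?addr0// => S' S'S.
  case: (boolP (is_cluster h S' w)) => [hS'|]; last by rewrite mul0r.
  by rewrite (is_cluster_inj hS' hS) eqxx in S'S.
rewrite mul0r big_seq big1// => S' S'N.
case: (boolP (is_cluster h S' w)) => [hS'|]; last by rewrite mul0r.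
by rewrite (is_cluster_inj hS' hS) (negPf SN) in S'N.
Qed.

Lemma cluster_obs_in0 N G h w : (forall S, ~~ is_cluster h S w) -> cluster_obs_in N G h w = 0.
Proof. by move=> hS; rewrite /cluster_obs_in big1// => S _; rewrite (negPf (hS S)) mul0r. Qed.

Lemma cluster_obs_in_ge0 N G h w : (forall S w, 0 <= G S w) -> 0 <= cluster_obs_in N G h w.
Proof. by move=> G0; apply: sumr_ge0 => S _; rewrite mulr_ge0. Qed.

Lemma cluster_obs_in_mono G h w : (forall S w, 0 <= G S w) ->
  nondecreasing_seq (fun N => cluster_obs_in N G h w).
Proof.
move=> G0 m n mn; have [[S hS _]|[hS _]] := cluster_obs_spec G h w.
  rewrite !(cluster_obs_inE _ _ hS) ler_wpM2r// ler_nat.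
  have [Sm|//] := boolP (S \in fpowerset (nbhd m)).
  rewrite fpowersetE in Sm; rewrite fpowersetE.
  by rewrite (fsubset_trans Sm)// nbhd_mono.
by rewrite !cluster_obs_in0.
Qed.

Lemma cvg_cluster_obs_in G h w : cluster_obs_in N G h w @[N --> \oo] --> cluster_obs G h w.
Proof.
have [[S hS ->]|[hS ->]] := cluster_obs_spec G h w; last first.
  by under eq_fun do rewrite cluster_obs_in0//; exact: cvg_cst.
have [N0 SN0] := is_cluster_nbhd hS.
apply: cvg_near_cst; near=> N; rewrite (cluster_obs_inE _ _ hS) fpowersetE.
rewrite (fsubset_trans SN0) ?mul1r// nbhd_mono//.
by near: N; exact: nbhs_infty_ge.
Unshelve. all: by end_near. Qed.

Hypothesis mphi : forall x, measurable_fun setT (phi x).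

Lemma measurable_is_cluster h S :
  measurable_fun setT (fun w => (is_cluster h S w)%:R : R).
Proof.
rewrite /is_cluster; case: (linked S) => /=; last exact: measurable_cst.
exact: (measurable_trig_closure mphi (tc_level_event _ _ (fset_uniq _))).
Qed.

Variable P : probability T R.

Section observable.
Variable G : {fset V} -> T -> R.
Hypothesis mG : forall S, measurable_fun setT (G S).

Lemma measurable_cluster_obs_in N h : measurable_fun setT (cluster_obs_in N G h).
Proof.
apply: measurable_sum => S; apply: measurable_funM; last exact: mG.
exact: measurable_is_cluster.
Qed.

Lemma measurable_cluster_obs h : measurable_fun setT (cluster_obs G h).
Proof.
apply: (measurable_fun_cvg (fun N => measurable_cluster_obs_in N h)) => w _.
exact: cvg_cluster_obs_in.
Qed.

Hypothesis G0 : forall S w, 0 <= G S w.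

Lemma integral_cluster_obs h : (\int[P]_w (cluster_obs G h w)%:E =
  limn (fun N => \sum_(S <- fpowerset (nbhd N))
    \int[P]_w ((is_cluster h S w)%:R * G S w)%:E))%E.
Proof.
transitivity (limn (fun N => \int[P]_w (cluster_obs_in N G h w)%:E)%E).
  rewrite -monotone_convergence//.
  - apply: eq_integral => w _; apply/esym/cvg_lim => //.
    by apply/fine_cvgP; split; [exact: nearW|exact: cvg_cluster_obs_in].
  - by move=> N; apply/measurable_EFinP; exact: measurable_cluster_obs_in.
  - by move=> N w _; rewrite lee_fin cluster_obs_in_ge0.
  - by move=> w _ m n mn; rewrite lee_fin cluster_obs_in_mono.
congr (limn _); apply/funext => N; rewrite -ge0_integral_sum//.
- by apply: eq_integral => w _; rewrite sumEFin.
- move=> S; apply/measurable_EFinP; apply: measurable_funM; last exact: mG.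
  exact: measurable_is_cluster.
- by move=> S w _; rewrite lee_fin mulr_ge0.
Qed.

End observable.

Lemma eq_integral_cluster_obs (G G' : {fset V} -> T -> R) h h' :
  (forall S, measurable_fun setT (G S)) -> (forall S w, 0 <= G S w) ->
  (forall S, measurable_fun setT (G' S)) -> (forall S w, 0 <= G' S w) ->
  (forall S, \int[P]_w ((is_cluster h S w)%:R * G S w)%:E =
     \int[P]_w ((is_cluster h' S w)%:R * G' S w)%:E)%E ->
  (\int[P]_w (cluster_obs G h w)%:E = \int[P]_w (cluster_obs G' h' w)%:E)%E.
Proof.
move=> mG G0 mG' G'0 GG'; rewrite !integral_cluster_obs//.
by congr (limn _); apply/funext => N; apply: eq_bigr => S _; exact: GG'.
Qed.

End clusters.

(** * Analyticity *)

Section analyticity.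
Variables (V : choiceType) (nbrs : V -> seq V) (R : realType).
Hypothesis Hgraph : simple_locally_finite_graph nbrs.
Hypothesis Hconn : connected_graph nbrs.
Hypothesis Htrans : transient nbrs R.
Variables (d : measure_display) (T : measurableType d) (P : probability T R).
Variables (phi : V -> T -> R).
Hypothesis Hphi : is_GFF nbrs P phi.
Variable X : {fset V}.
Notation is_cluster := (is_cluster nbrs phi X).
Notation obs := (cluster_obs nbrs phi X).
Implicit Types (S : {fset V}) (h t : R) (w : T).

Let mphi x : measurable_fun setT (phi x). Proof. by case: Hphi => + _; apply. Qed.

(* The one-vertex graph satisfies [transient] (the walk vanishes after time 0); there
   all capacities and Green functions are 0, the latter through [0^-1 = 0]. *)
Lemma deg_dichotomy : (forall x, (0 < deg nbrs x)%N) \/ (forall x, deg nbrs x = 0%N).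
Proof.
have [[x x0]|H] := pselect (exists x, deg nbrs x = 0%N); last first.
  by left=> x; rewrite lt0n; apply/eqP => x0; apply: H; exists x.
right=> y; have [[|z s] [/= + sy]] := Hconn x y; first by rewrite -sy.
by rewrite /adj (size0nil x0).
Qed.

Definition hull_capacity S : R := capacity nbrs R (hull nbrs X S).
Definition hull_charge S w : R :=
  lin_form (hull nbrs X S) (eqm nbrs R (hull nbrs X S)) (phi ^~ w).
Notation c := hull_capacity.
Notation M := hull_charge.

Let eqm_deg0 : (forall x, deg nbrs x = 0%N) -> forall K x, eqm nbrs R K x = 0.
Proof. by move=> d0 K x; rewrite /eqm d0 mul0r. Qed.

Lemma hull_capacity_ge0 S : 0 <= c S.
Proof.
have [dp|d0] := deg_dichotomy; first exact: capacity_ge0.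
by rewrite /hull_capacity capacityE big1// => x _; exact: eqm_deg0.
Qed.

Lemma capacity_le_hull S : capacity nbrs R (Defs.fclosure nbrs S) <= c S.
Proof.
have [dp|d0] := deg_dichotomy; first exact/capacity_le/fsubsetUl.
by rewrite /hull_capacity !capacityE !big1// => x _; exact: eqm_deg0.
Qed.

(* The equilibrium measure of [hull S] does not charge [S], and the field is below
   [h] on the rest of [hull S]. *)
Lemma hull_charge_le h S w : is_cluster h S w -> M S w <= h * c S.
Proof.
move=> /andP[_ /allP lev]; rewrite /hull_charge /hull_capacity capacityE /lin_form big_distrr/=.
rewrite big_seq [leRHS]big_seq; apply: ler_sum => x xK.
have [dp|d0] := deg_dichotomy; last by rewrite eqm_deg0// mul0r mulr0.
have [xS|xS] := boolP (x \in S).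
  rewrite /eqm escape_prob_interior// ?mulr0 ?mul0r ?mulr0// => y xy.
  by rewrite /hull in_fsetU; apply/orP; left; apply/in_fclosure; right; exists x.
rewrite mulrC ler_wpM2r ?eqm_ge0// ltW//.
by have := lev x xK; rewrite (negPf xS).
Qed.

Definition density t S w : R := expR (- (t * M S w) - t ^+ 2 * c S / 2).

Lemma measurable_hull_charge S : measurable_fun setT (M S).
Proof. exact: measurable_lin_form. Qed.

Lemma measurable_density t S : measurable_fun setT (density t S).
Proof.
apply: measurableT_comp => //; apply: measurable_funB => //.
by apply: measurableT_comp => //; apply: measurable_funM => //; exact: measurable_hull_charge.
Qed.

(** On the one-vertex graph or on an empty hull, the density is 1 and the Green function vanishes on
    the hull; the signs of [h] and [h + t] serve this case. Otherwise the hull has positive capacity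
    and [cameron_martin] applies. *)
Lemma cluster_shift h t S : h <= 0 -> h + t <= 0 ->
  (\int[P]_w ((is_cluster h S w)%:R * density t S w)%:E =
   \int[P]_w ((is_cluster (h + t) S w)%:R)%:E)%E.
Proof.
move=> h0 ht0; rewrite /is_cluster; case: (linked _ _ S) => /=; last first.
  by under eq_integral do rewrite mul0r.
have pc a := (Hphi.2 (hull nbrs X S) a).1.
have ps a := (Hphi.2 (hull nbrs X S) a).2.
have null : (forall x y, x \in hull nbrs X S -> y \in hull nbrs X S ->
      green nbrs R x y = 0) ->
    (forall w, density t S w = 1) ->
    (\int[P]_w ((level_event (hull nbrs X S) (fun x => x \in S) h (phi ^~ w))%:R * density t S w)%:E =
   \int[P]_w ((level_event (hull nbrs X S) (fun x => x \in S) (h + t) (phi ^~ w))%:R)%:E)%E.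
  move=> g0 d1; under eq_integral do rewrite d1 mulr1.
  exact: (level_event_null mphi pc ps).
have [dp|d0] := deg_dichotomy; last first.
  apply: null => [x y _ _|w]; first by rewrite /green d0 invr0 mulr0.
  rewrite /density /hull_charge /hull_capacity capacityE big1 => [|x _]; last exact: eqm_deg0.
  rewrite /lin_form big1 => [|x _]; last by rewrite eqm_deg0// mul0r.
  by rewrite !mulr0 mul0r subr0 oppr0 expR0.
have [K0|[x xK]] := fset_0Vmem (hull nbrs X S).
  apply: null => [x y|w]; first by rewrite K0.
  rewrite /density /hull_charge /hull_capacity capacityE K0 /lin_form !big_seq_fset0.
  by rewrite !mulr0 mul0r subr0 oppr0 expR0.
apply: (cameron_martin mphi pc ps).
- exact: green_sym.
- by move=> y yK; exact: potential_eq1.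
- exact: capacity_gt0 xK.
Qed.

Lemma cluster_obs_shift (W : {fset V} -> R) h t : (forall S, 0 <= W S) -> h <= 0 -> h + t <= 0 ->
  (\int[P]_w (obs (fun S _ => W S) (h + t) w)%:E =
   \int[P]_w (obs (fun S w => W S * density t S w) h w)%:E)%E.
Proof.
move=> W0 h0 ht0; apply: eq_integral_cluster_obs => // [S|S w|S].
- by apply: measurable_funM => //; exact: measurable_density.
- by rewrite mulr_ge0// expR_ge0.
transitivity ((W S)%:E * \int[P]_w ((is_cluster (h + t) S w)%:R)%:E)%E.
  rewrite -ge0_integralZl_EFin//.
  - by apply: eq_integral => w _; rewrite -EFinM mulrC.
  - by apply/measurable_EFinP; exact: measurable_is_cluster.
rewrite -cluster_shift// -ge0_integralZl_EFin//.
- by apply: eq_integral => w _; rewrite -EFinM mulrCA.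
- by move=> w _; rewrite lee_fin mulr_ge0// expR_ge0.
- apply/measurable_EFinP; apply: measurable_funM; first exact: measurable_is_cluster.
  exact: measurable_density.
Qed.

(* Comparison with level [0], where the density is at most [expR (- h ^+ 2 * c S / 2)]. *)
Lemma cluster_obs_expR_capacity_le1 h a : h <= 0 -> a <= h ^+ 2 / 2 ->
  (\int[P]_w (obs (fun S _ => expR (a * c S)) h w)%:E <= 1)%E.
Proof.
move=> h0 ah; rewrite -[h in obs _ h]add0r cluster_obs_shift ?add0r//.
rewrite -(probability_setT P) -[leRHS]mul1e -integral_cst//.
apply: ge0_le_integral => //.
- by move=> w _; rewrite lee_fin cluster_obs_ge0// => S _; rewrite mulr_ge0 ?expR_ge0.
- apply/measurable_EFinP; apply: measurable_cluster_obs => // S.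
  by apply: measurable_funM => //; exact: measurable_density.
move=> w _; rewrite lee_fin.
have [[S hS ->]|[_ ->]] := cluster_obs_spec nbrs phi X (fun S w => expR (a * c S) * density h S w) 0 w; last exact: ler01.
rewrite -expRD -[leRHS]expR0 ler_expR.
have := hull_charge_le hS; rewrite mul0r => M0.
have hM : 0 <= h * M S w by rewrite mulr_le0.
have : a * c S <= h ^+ 2 / 2 * c S by rewrite ler_wpM2r// hull_capacity_ge0.
lra.
Qed.

(** Growth is measured by the capacity of the hull, which exceeds that of the closure and is the one
    that the exponential moment controls. *)
Definition subexp (f : {fset V} -> R) := forall eta, 0 < eta ->
  exists2 C, 0 <= C & forall S, `|f S| <= C * expR (eta * c S).

Section real_observable.
Variable f : {fset V} -> R.
Hypothesis Hf : subexp f.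

(** The gap [h^2 / 2 - b] to the available exponential moment is the exponent spent on the growth of
    [f]. *)
Lemma integral_cluster_obs_expR_lty h b : h < 0 -> b < h ^+ 2 / 2 ->
  (\int[P]_w (obs (fun S _ => (`|f S| * expR (b * c S))%R) h w)%:E < +oo)%E.
Proof.
move=> h0 bh; have [C C0 fC] : exists2 C, 0 <= C &
    forall S, `|f S| <= C * expR ((h ^+ 2 / 2 - b) * c S).
  by apply: Hf; rewrite subr_gt0.
apply: (@le_lt_trans _ _ (\int[P]_w (C%:E * (obs (fun S _ => expR (h ^+ 2 / 2 * c S)) h w)%:E))%E).
  apply: ge0_le_integral => //.
  - by move=> w _; rewrite lee_fin cluster_obs_ge0// => S _; rewrite mulr_ge0 ?expR_ge0.
  - by apply/measurable_EFinP; apply: measurable_cluster_obs.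
  - by apply: measurable_funeM; apply/measurable_EFinP; apply: measurable_cluster_obs.
  move=> w _; rewrite -EFinM lee_fin.
  rewrite (cluster_obs_comp _ _ _ _ _ _ (u := fun x => C * x)) ?mulr0//.
  apply: cluster_obs_le => S _.
  apply: (@le_trans _ _ (C * expR ((h ^+ 2 / 2 - b) * c S) * expR (b * c S))).
    by rewrite ler_wpM2r ?expR_ge0.
  by rewrite -mulrA -expRD -mulrDl subrK.
rewrite ge0_integralZl_EFin//; last 2 first.
- by move=> w _; rewrite lee_fin cluster_obs_ge0// => S _; rewrite expR_ge0.
- by apply/measurable_EFinP; apply: measurable_cluster_obs.
apply: (@le_lt_trans _ _ (C%:E * 1)%E); last by rewrite mule1 ltry.
by rewrite lee_wpmul2l ?lee_fin// cluster_obs_expR_capacity_le1// ltW.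
Qed.

Lemma integrable_cluster_obs h : h < 0 ->
  P.-integrable setT (fun w => (obs (fun S _ => f S) h w)%:E).
Proof.
move=> h0; apply/integrableP; split.
  by apply/measurable_EFinP; apply: measurable_cluster_obs.
have /(integral_cluster_obs_expR_lty h0) : 0 < h ^+ 2 / 2.
  by rewrite divr_gt0// exprn_even_gt0//= lt_eqF.
apply: le_lt_trans; apply: ge0_le_integral => //.
- by do 2 apply: measurableT_comp => //; apply: measurable_cluster_obs.
- by apply/measurable_EFinP; apply: measurable_cluster_obs.
move=> w _; rewrite lee_fin norm_cluster_obs; apply: cluster_obs_le => S _.
by rewrite mul0r expR0 mulr1.
Qed.

(* At a negative level [M S w <= 0] on the cluster event, so the exponential of
   [|M S w|] is again a density. *)
Lemma integrable_cluster_obs_density h r : h < 0 -> 0 <= r -> r <= - h / 4 ->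
  P.-integrable setT (fun w => (obs (fun S w => `|f S| *
    expR (r * `|M S w| + r ^+ 2 * (c S / 2))) h w)%:E).
Proof.
move=> h0 r0 rh.
have mG S : measurable_fun setT (fun w => `|f S| * expR (r * `|M S w| + r ^+ 2 * (c S / 2))).
  apply: measurable_funM => //; apply: measurableT_comp => //.
  apply: measurable_funD => //; apply: measurable_funM => //.
  by apply: measurableT_comp => //; exact: measurable_hull_charge.
apply/integrableP; split.
  by apply/measurable_EFinP; apply: measurable_cluster_obs.
have hr0 : h + r < 0 by lra.
(* From [r <= - h / 4] follows [h + r <= - 3 r], so [(h + r)^2 / 2] is at least [9 r^2 / 2];
   strictness at [r = 0] comes from [h < 0]. *)
have rhr : r ^+ 2 < (h + r) ^+ 2 / 2 by nra.
have := integral_cluster_obs_expR_lty hr0 rhr.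
rewrite cluster_obs_shift; [|by move=> S; rewrite mulr_ge0 ?expR_ge0|exact: ltW|exact: ltW].
apply: le_lt_trans; apply: ge0_le_integral => //.
- by apply: measurableT_comp => //; apply/measurable_EFinP; apply: measurable_cluster_obs.
- apply/measurable_EFinP; apply: measurable_cluster_obs => // S.
  by apply: measurable_funM => //; exact: measurable_density.
move=> w _; rewrite lee_fin norm_cluster_obs; apply: cluster_obs_le => S hS.
rewrite ger0_norm ?mulr_ge0 ?expR_ge0// -[leRHS]mulrA ler_wpM2l// /density -expRD ler_expR.
have M0 : M S w <= 0.
  by rewrite (le_trans (hull_charge_le hS))// mulr_le0_ge0 ?hull_capacity_ge0// ltW.
rewrite ler0_norm//; lra.
Qed.

(** The formula for nonnegative weights is applied to [|f| + f] and to [|f|]; both integrals are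
    finite, so they can be subtracted. *)
Lemma cluster_obs_shift_real h t : h < 0 -> h + t < 0 ->
  (\int[P]_w (obs (fun S _ => f S) (h + t) w)%:E =
   \int[P]_w (obs (fun S w => f S * density t S w) h w)%:E)%E.
Proof.
move=> h0 ht0.
have fp0 S : 0 <= `|f S| + f S by rewrite -lerBlDr sub0r -normrN ler_norm.
have mD S (W : R) : measurable_fun setT (fun w => W * density t S w).
  by apply: measurable_funM => //; exact: measurable_density.
have ep := @cluster_obs_shift (fun S => `|f S| + f S) h t fp0 (ltW h0) (ltW ht0).
have en := @cluster_obs_shift (fun S => `|f S|) h t (fun S => normr_ge0 _) (ltW h0) (ltW ht0).
have iabs : (\int[P]_w (obs (fun S _ => `|f S|) (h + t) w)%:E < +oo)%E.
  have /(integral_cluster_obs_expR_lty ht0) : 0 < (h + t) ^+ 2 / 2.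
    by rewrite divr_gt0// exprn_even_gt0//= lt_eqF.
  have -> // : (fun S (_ : T) => `|f S| * expR (0 * c S)) = (fun S _ => `|f S|).
  by apply/funext => S; apply/funext => w; rewrite mul0r expR0 mulr1.
have in1 : P.-integrable setT (fun w => (obs (fun S _ => `|f S|) (h + t) w)%:E).
  apply/integrableP; split; first by apply/measurable_EFinP; apply: measurable_cluster_obs.
  by under eq_integral do rewrite gee0_abs ?lee_fin ?cluster_obs_ge0//.
have in2 : P.-integrable setT (fun w => (obs (fun S w => `|f S| * density t S w) h w)%:E).
  apply/integrableP; split; first by apply/measurable_EFinP; apply: measurable_cluster_obs.
  have ge0 w : 0 <= obs (fun S w => `|f S| * density t S w) h w.
    by rewrite cluster_obs_ge0// => S _; rewrite mulr_ge0 ?expR_ge0.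
  under eq_integral do rewrite gee0_abs ?lee_fin ?ge0//.
  by rewrite -en.
have ip1 : P.-integrable setT (fun w => (obs (fun S _ => `|f S| + f S) (h + t) w)%:E).
  apply: (@le_integrable _ _ _ P setT measurableT _
    (fun w => 2%:E * (obs (fun S _ => `|f S|) (h + t) w)%:E)%E).
  - by apply/measurable_EFinP; apply: measurable_cluster_obs.
  - move=> w _; rewrite -EFinM lee_fin norm_cluster_obs [leRHS]ger0_norm ?mulr_ge0 ?cluster_obs_ge0//.
    rewrite (cluster_obs_comp _ _ _ _ _ _ (u := fun x => 2 * x)) ?mulr0//.
    apply: cluster_obs_le => S _; rewrite ger0_norm// mulr_natl mulr2n lerD2l; exact: ler_norm.
  - exact: integrableZl.
have ip2 : P.-integrable setT (fun w => (obs (fun S w => (`|f S| + f S) * density t S w) h w)%:E).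
  apply/integrableP; split; first by apply/measurable_EFinP; apply: measurable_cluster_obs.
  have ge0 w : 0 <= obs (fun S w => (`|f S| + f S) * density t S w) h w.
    by rewrite cluster_obs_ge0// => S _; rewrite mulr_ge0 ?expR_ge0.
  under eq_integral do rewrite gee0_abs ?lee_fin ?ge0//.
  have /integrableP[_] := ip1; rewrite -ep.
  by under eq_integral do rewrite gee0_abs ?lee_fin ?cluster_obs_ge0//.
transitivity (\int[P]_w ((obs (fun S _ => `|f S| + f S) (h + t) w)%:E -
    (obs (fun S _ => `|f S|) (h + t) w)%:E))%E.
  apply: eq_integral => w _; rewrite -EFinB; congr (_%:E); rewrite /cluster_obs.
  by case: ifP => _; rewrite ?subrr// [_ + f _]addrC addrK.
rewrite integralB// ep en -integralB//.
apply: eq_integral => w _; rewrite -EFinB; congr (_%:E); rewrite /cluster_obs.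
by case: ifP => _; rewrite ?subrr// mulrDl [_ + f _ * _]addrC addrK.
Qed.

(** With these arguments [expR2_coef] gives the coefficient of [t^n] in [density t S w], a rescaled
    Hermite polynomial in [M S w]. *)
Definition taylor_coef h n : R :=
  \int[P]_w (obs (fun S w => f S * expR2_coef (- M S w) (- (c S / 2)) n) h w).

Lemma taylor_cvg h t : h < 0 -> `|t| < - h / 4 ->
  \sum_(n < N) taylor_coef h n * t ^+ n @[N --> \oo] -->
  fine (\int[P]_w (obs (fun S _ => f S) (h + t) w)%:E).
Proof.
move=> h0 th; have r0 : 0 < - h / 4 by apply: le_lt_trans th.
have ht0 : h + t < 0 by have := ler_norm t; lra.
have mk S n : measurable_fun setT (fun w => expR2_coef (- M S w) (- (c S / 2)) n).
  rewrite /expR2_coef; under eq_fun do rewrite big_mkcond.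
  apply: measurable_sum => j; have [_|_] := leqP j.*2 n; last exact: measurable_cst.
  apply: measurable_funM => //; apply: measurable_funM => //; apply: measurable_funX.
  by apply: measurableT_comp => //; exact: measurable_hull_charge.
have mfk S n : measurable_fun setT (fun w => f S * expR2_coef (- M S w) (- (c S / 2)) n).
  exact: measurable_funM.
have c2 S : `|- (c S / 2)| = c S / 2 by rewrite normrN ger0_norm// divr_ge0// hull_capacity_ge0.
(* A single coefficient is bounded through the majorant at [- h / 4], divided by [(- h / 4)^n]; the
   given [t] could be 0. *)
have int_k n : P.-integrable setT
    (EFin \o obs (fun S w => f S * expR2_coef (- M S w) (- (c S / 2)) n) h).
  have := integrable_cluster_obs_density h0 (ltW r0) (lexx _).
  move=> /(integrableZl measurableT ((- h / 4) ^+ n)^-1); apply: le_integrable => //.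
    by apply/measurable_EFinP; apply: measurable_cluster_obs.
  move=> w _; rewrite -EFinM lee_fin norm_cluster_obs (le_trans _ (ler_norm _))//.
  rewrite (cluster_obs_comp _ _ _ _ _ _ (u := fun x => ((- h / 4) ^+ n)^-1 * x)) ?mulr0//.
  apply: cluster_obs_le => S _; rewrite normrM mulrCA ler_wpM2l// ler_pdivlMl ?exprn_gt0//.
  have := expR2_term_le (- h / 4) (- M S w) (- (c S / 2)) n.
  by rewrite c2 normrN (gtr0_norm r0) normrM (ger0_norm (exprn_ge0 _ (ltW r0))).
have partialE N : \sum_(n < N) taylor_coef h n * t ^+ n =
    fine (\int[P]_w (obs (fun S w => f S *
      \sum_(n < N) t ^+ n * expR2_coef (- M S w) (- (c S / 2)) n) h w)%:E).
  have -> : (fun w => (obs (fun S w => f S *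
      \sum_(n < N) t ^+ n * expR2_coef (- M S w) (- (c S / 2)) n) h w)%:E) =
    (fun w => \sum_(n < N) ((t ^+ n)%:E *
      (obs (fun S w => f S * expR2_coef (- M S w) (- (c S / 2)) n) h w)%:E))%E.
    apply/funext => w; under [RHS]eq_bigr do rewrite -EFinM.
    rewrite sumEFin; congr (_%:E); rewrite /cluster_obs; case: ifP => _; last first.
      by rewrite big1// => n _; rewrite mulr0.
    by rewrite big_distrr/=; apply: eq_bigr => n _; rewrite mulrCA.
  rewrite integral_sum//; last by move=> n; apply: integrableZl => //; exact: int_k.
  have fink n : (\int[P]_w (obs (fun S w => f S *
      expR2_coef (- M S w) (- (c S / 2)) n) h w)%:E)%E \is a fin_num.
    by apply: integrable_fin_num => //; exact: int_k.
  transitivity (fine (\sum_(n < N) (taylor_coef h n * t ^+ n)%:E)%E).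
    by rewrite sumEFin.
  congr fine; apply: eq_bigr => n _; rewrite integralZl//; last exact: int_k.
  by rewrite -(fineK (fink n)) -EFinM mulrC.
under eq_fun do rewrite partialE.
rewrite cluster_obs_shift_real//.
have intD := integrable_cluster_obs_density h0 (normr_ge0 t) (ltW th).
have [|||||_ _] := @dominated_convergence _ _ _ P setT measurableT
  (fun N w => (obs (fun S w => f S *
      \sum_(n < N) t ^+ n * expR2_coef (- M S w) (- (c S / 2)) n) h w)%:E)
  (fun w => (obs (fun S w => f S * density t S w) h w)%:E)
  (fun w => (obs (fun S w => `|f S| *
    expR (`|t| * `|M S w| + `|t| ^+ 2 * (c S / 2))) h w)%:E).
- move=> N; apply/measurable_EFinP; apply: measurable_cluster_obs => // S.
  apply: measurable_funM => //; apply: measurable_sum => n.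
  exact: measurable_funM.
- apply/measurable_EFinP; apply: measurable_cluster_obs => // S.
  by apply: measurable_funM => //; exact: measurable_density.
- apply: aeW => w _; apply/fine_cvgP; split; first exact: nearW.
  rewrite /comp/=; have [[S hS ->]|[hS ->]] := cluster_obs_spec nbrs phi X (fun S w => f S * density t S w) h w.
    under eq_fun do rewrite (cluster_obsE _ hS).
    apply: cvgM; first exact: cvg_cst.
    rewrite /density (_ : - (t * M S w) - _ = t * - M S w + t ^+ 2 * - (c S / 2)); last by field.
    exact: expR2_series.
  apply: cvg_near_cst; apply: nearW => N.
  by have [[S' hS']|[_ ->//]] := cluster_obs_spec nbrs phi X (fun S w => f S *
      \sum_(n < N) t ^+ n * expR2_coef (- M S w) (- (c S / 2)) n) h w; rewrite (negPf (hS S')) in hS'.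
- exact: intD.
- apply: aeW => w N _; rewrite lee_fin norm_cluster_obs; apply: cluster_obs_le => S _.
  rewrite normrM ler_wpM2l//.
  have := expR2_partial_le t (- M S w) (- (c S / 2)) N.
  by rewrite c2 normrN real_normK ?num_real.
have fin : (\int[P]_w (obs (fun S w => f S * density t S w) h w)%:E)%E \is a fin_num.
  rewrite -cluster_obs_shift_real//; apply: integrable_fin_num => //; exact: integrable_cluster_obs.
rewrite -(fineK fin); exact: fine_cvg.
Qed.

End real_observable.
End analyticity.

(** * Real and imaginary parts of complex limits *)

Section complex_series.
Local Open Scope complex_scope.
Variable R : realType.
Implicit Types (z : R[i]).

Lemma norm_complex_le z : `|z| <= (`|complex.Re z| + `|complex.Im z|)%:C.
Proof.
case: z => a b /=; rewrite normc_def lecR /=.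
rewrite -[leRHS]ger0_norm ?addr_ge0// -sqrtr_sqr ler_wsqrtr//.
rewrite sqrrD !real_normK ?num_real// -addrA [X in _ <= _ + X]addrC addrA lerDl.
by rewrite mulrn_wge0// mulr_ge0.
Qed.

Lemma normc_ge_Im z : `|complex.Im z|%:C <= `|z|.
Proof.
case: z => a b; rewrite normc_def lecR /= -sqrtr_sqr ler_wsqrtr//.
by rewrite lerDr sqr_ge0.
Qed.

Lemma cvg_complex (u v : nat -> R) (a b : R) :
  u n @[n --> \oo] --> a -> v n @[n --> \oo] --> b ->
  (fun n => u n +i* v n : (R[i])^o) @ \oo --> ((a +i* b) : (R[i])^o).
Proof.
move=> ua vb; apply/cvgrPdist_lt => e e0.
(* A positive element of [R[i]] has zero imaginary part, so the tolerance is real. *)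
have eE : e = (complex.Re e)%:C.
  by move: e0; case: e => x y; rewrite ltcE /= => /andP[/eqP -> _].
have e20 : 0 < complex.Re e / 2.
  by rewrite divr_gt0//; move: e0; rewrite ltcE => /andP[].
move/cvgrPdist_lt : ua => /(_ _ e20) ua; move/cvgrPdist_lt : vb => /(_ _ e20) vb.
near=> n; rewrite eE; apply: le_lt_trans (norm_complex_le _) _ => /=.
rewrite ltcR [ltRHS]splitr ltrD//; near: n; [exact: ua|exact: vb].
Unshelve. all: by end_near. Qed.

Lemma sum_complex (x y : nat -> R) (t : R) N :
  \sum_(n < N) (x n +i* y n) * (t%:C) ^+ n =
  (\sum_(n < N) x n * t ^+ n) +i* (\sum_(n < N) y n * t ^+ n).
Proof.
elim: N => [|N IH]; first by rewrite !big_ord0.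
rewrite !big_ord_recr/= IH -rmorphXn/=.
by apply/eqP; rewrite eq_complex /= !mulr0 subr0 add0r !eqxx.
Qed.

End complex_series.

Theorem theorem1p5 (V : choiceType) (nbrs : V -> seq V)
  (Hgraph : simple_locally_finite_graph nbrs)
  (Hconn : connected_graph nbrs)
  (R : realType) (Htrans : transient nbrs R)
  (d : measure_display) (T : measurableType d) (P : probability T R)
  (phi : V -> T -> R) (Hphi : is_GFF nbrs P phi)
  (F : {fset V} -> R[i]) (HF : subexponential_growth nbrs F)
  (X : {fset V}) :
  (forall h : R, h < 0 -> obs_integrable nbrs P phi F X h) /\
  analytic_on [set h : R | h < 0] (Fbar nbrs P phi F X).
Proof.
pose re S := complex.Re (F S); pose im S := complex.Im (F S).
have bound eta : 0 < eta -> exists2 C, 0 <= C & forall S,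
    `|F S| <= (C * expR (eta * hull_capacity nbrs R X S))%:C%C.
  (* [subexponential_growth] leaves the sign of [C] open. The bound at the empty set gives [0 <= C],
     which is needed to enlarge the capacity in the exponent to that of the hull. *)
  move=> eta0; have [C FC] := HF eta eta0; have C0 : 0 <= C.
    have := FC fset0; move=> /(le_trans (normr_ge0 _)).
    by rewrite ler0c pmulr_lge0// expR_gt0.
  exists C; first exact: C0.
  move=> S; apply: le_trans (FC S) _; rewrite lecR.
  apply: ler_wpM2l => //; rewrite ler_expR; apply: ler_wpM2l; first exact: ltW.
  exact: capacity_le_hull.
have sre : subexp nbrs X re.
  move=> eta /bound[C C0 FC]; exists C => // S.
  by rewrite -lecR (le_trans _ (FC S))// normc_ge_Re.
have sim : subexp nbrs X im.
  move=> eta /bound[C C0 FC]; exists C => // S.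
  by rewrite -lecR (le_trans _ (FC S))// normc_ge_Im.
have reE h w : complex.Re (obs_fin F (Defs.cluster nbrs phi h X w)) =
    cluster_obs nbrs phi X (fun S _ => re S) h w by rewrite /obs_fin /cluster_obs; case: ifP.
have imE h w : complex.Im (obs_fin F (Defs.cluster nbrs phi h X w)) =
    cluster_obs nbrs phi X (fun S _ => im S) h w by rewrite /obs_fin /cluster_obs; case: ifP.
split=> [h h0|h0 /= h00].
  split.
    under eq_fun do rewrite reE; exact: integrable_cluster_obs.
  under eq_fun do rewrite imE; exact: integrable_cluster_obs.
exists (fun n => taylor_coef nbrs P phi X re h0 n +i* taylor_coef nbrs P phi X im h0 n)%C.
exists (- h0 / 4); split; first by lra.
move=> h hh; under eq_fun do rewrite sum_complex.
rewrite /Fbar; under eq_integral do rewrite reE.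
under [X in (_ +i* fine X)%C]eq_integral do rewrite imE.
have -> : h = h0 + (h - h0) by rewrite addrC subrK.
by apply: cvg_complex; rewrite addrC addKr; apply: taylor_cvg.
Qed.
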